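(* Let $(X,d,\mathfrak m)$ be a compact metric measure space, let $K\in\mathbb R$, and let $(d_n)_{n\in\mathbb N}$ be a sequence of distances on $X$, inducing the same topology as $d$, such that there is a sequence $\varepsilon_n\to0$ with $|d_n(x,y)-d(x,y)|<\varepsilon_n$ for every $x,y\in X$. Let $L>0$ and assume that for every $n$ there is an $L$-Lipschitz consistent geodesic flow $G_n$ for $(X,d_n,\mathfrak m)$. Let $G$ be an $L$-Lipschitz consistent geodesic flow for $(X,d,\mathfrak m)$ such that, after passing to a subsequence (not relabeled), $G_n$ converges uniformly to $G$. Suppose that there exists a consistent plan selection $\Pi$ on $(X,d,\mathfrak m)$ associated to $G$ such that for every $\mu,\nu\in\mathscr P_{ac}(X)$ there exists a sequence $\pi_n\in\mathrm{OptPlans}_{d_n}(\mu,\nu)$ satisfying: 1. $\pi_n\rightharpoonup\Pi(\mu,\nu)$ weakly, up to the extraction of a subsequence; 2. the $K$-convexity of the entropy holds along the $d_n$-Wasserstein geodesic $(G_n)_\#\pi_n$ with respect to $d_n$, i.e. for every $t\in[0,1]$ $$\mathrm{Ent}\big([(G_n)_t]_\#\pi_n\big)\le(1-t)\,\mathrm{Ent}(\mu)+t\,\mathrm{Ent}(\nu)-\frac K2\,t(1-t)\,\big(W_2^{d_n}\big)^2(\mu,\nu).$$ Then $(X,d,\mathfrak m)$ is a very strict $\mathsf{CD}(K,\infty)$ space.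
   Context: A metric measure space is a triple $(X,d,\mathfrak m)$ with $(X,d)$ a Polish metric space and $\mathfrak m$ a non-negative, non-null Borel measure finite on bounded sets. $\mathscr P_2(X)$: Borel probability measures with finite second moment; $\mathscr P_{ac}(X)$: those in $\mathscr P_2(X)$ absolutely continuous with respect to $\mathfrak m$. $\mathrm{OptPlans}(\mu,\nu)$: couplings of $\mu,\nu$ minimizing $\int d^2\,d\pi$; $W_2^2(\mu,\nu)$ is the minimum value; $\mathrm{OptPlans}_{d_n}$ and $W_2^{d_n}$ are the same objects for the distance $d_n$. $\mathrm{Ent}(\mu)=\int\rho\log\rho\,d\mathfrak m$ if $\mu=\rho\mathfrak m$, and $+\infty$ if $\mu\not\ll\mathfrak m$. $\mathrm{Geo}(X)\subset C([0,1],X)$: constant speed geodesics; $e_t(\gamma)=\gamma(t)$; $(\mathrm{restr}_s^t\gamma)(r)=\gamma((1-r)s+rt)$. $\mathrm{OptGeo}(\mu,\nu)$: probability measures $\eta$ on $C([0,1],X)$ concentrated on $\mathrm{Geo}(X)$ with $(e_0,e_1)_\#\eta\in\mathrm{OptPlans}(\mu,\nu)$. Very strict $\mathsf{CD}(K,\infty)$: for all $\mu_0,\mu_1\in\mathscr P_{ac}(X)$ there is $\eta\in\mathrm{OptGeo}(\mu_0,\mu_1)$ such that for all $t_0<t_1$ in $[0,1]$ and all bounded Borel $f:\mathrm{Geo}(X)\to[0,\infty)$ with $\int f\,d\eta=1$, setting $\sigma=(\mathrm{restr}_{t_0}^{t_1})_\#(f\eta)$ and $\sigma_t=(e_t)_\#\sigma$,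 one has $\mathrm{Ent}(\sigma_t)\le(1-t)\mathrm{Ent}(\sigma_0)+t\,\mathrm{Ent}(\sigma_1)-\frac K2t(1-t)W_2^2(\sigma_0,\sigma_1)$ for all $t\in[0,1]$. Consistent geodesic flow for $(X,d)$: a measurable map $G:X\times X\to C([0,1],X)$ such that 1) for every $x,y\in X$, $G(x,y)\in\mathrm{Geo}(X)$ with $G(x,y)(0)=x$, $G(x,y)(1)=y$; 2) $\mathrm{restr}_s^t\,G(x,y)=G\big(G(x,y)(s),G(x,y)(t)\big)$ for every $s<t$ in $(0,1)$ and $x,y\in X$. It is $L$-Lipschitz if $\sup_{t\in[0,1]}d(G(x_1,y_1)(t),G(x_2,y_2)(t))\le L(d^2(x_1,x_2)+d^2(y_1,y_2))^{1/2}$ for all $x_i,y_i\in X$. Write $G_r:=e_r\circ G$ (and $(G_n)_r:=e_r\circ G_n$). For $G_n$ these notions refer to $d_n$. Consistent plan selection associated to $G$: a map $\Pi:\mathscr P_{ac}(X)\times\mathscr P_{ac}(X)\to\mathscr P(X\times X)$ such that 1) $\Pi(\mu,\nu)\in\mathrm{OptPlans}(\mu,\nu)$ for all $\mu,\nu\in\mathscr P_{ac}(X)$; 2) for all $\mu,\nu\in\mathscr P_{ac}(X)$, $s<t$ in $[0,1]$ and bounded Borel $f:X\times X\to[0,\infty)$ with $\int f\,d\Pi(\mu,\nu)=1$, if $(G_s)_\#(f\cdot\Pi(\mu,\nu)),(G_t)_\#(f\cdot\Pi(\mu,\nu))\in\mathscr P_{ac}(X)$, then $(G_s,G_t)_\#(f\cdot\Pi(\mu,\nu))=\Pi\big((G_s)_\#(f\cdot\Pi(\mu,\nu)),(G_t)_\#(f\cdot\Pi(\mu,\nu))\big)$.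 *)

(* Defs.v *)
From HB Require Import structures.
From mathcomp Require Import all_boot all_order all_algebra.
From mathcomp Require Import all_classical all_reals all_analysis.

Set Implicit Arguments.
Unset Strict Implicit.
Unset Printing Implicit Defensive.
Import Order.TTheory GRing.Theory Num.Theory.
Import numFieldNormedType.Exports.
Local Open Scope classical_set_scope.
Local Open Scope ring_scope.

(* Measurable types are pointed in MathComp-Analysis. A space carrying a
   non-null measure is nonempty, so asking for a point loses nothing. *)
#[short(type="pmetricType")]
HB.structure Definition PointedMetric (R : numDomainType) :=
  { M of Metric R M & Pointed M }.

(* X with its Borel sigma-algebra. The product type [borel X * borel X] carries
   the product sigma-algebra, which is the Borel one when X is separable. *)
Notation borel X := (g_sigma_algebraType (@open X)).

Definition I01 (R : realType) : topologicalType :=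
  set_type (`[0, 1]%classic : set R).

Definition rv {R : realType} (t : I01 R) : R := set_val t.

Lemma rv_itv {R : realType} (t : I01 R) : 0 <= rv t <= 1.
Proof. by have := set_valP t; rewrite /rv /= in_itv. Qed.

Lemma mkI01_subproof {R : realType} (x : R) :
  0 <= x <= 1 -> x \in (`[0, 1]%classic : set R).
Proof. by move=> x01; rewrite inE /= in_itv. Qed.

Definition mkI01 {R : realType} (x : R) (x01 : 0 <= x <= 1) : I01 R :=
  exist _ x (mkI01_subproof x01).

Lemma itv0 {R : realType} : 0 <= (0 : R) <= 1.
Proof. by rewrite lexx ler01. Qed.

Lemma itv1 {R : realType} : 0 <= (1 : R) <= 1.
Proof. by rewrite lexx ler01. Qed.

Definition I0 {R : realType} : I01 R := mkI01 itv0.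
Definition I1 {R : realType} : I01 R := mkI01 itv1.

Lemma conv_itv {R : realType} (s t r : I01 R) :
  0 <= (1 - rv r) * rv s + rv r * rv t <= 1.
Proof.
have /andP[s0 s1] := rv_itv s; have /andP[t0 t1] := rv_itv t.
have /andP[r0 r1] := rv_itv r; have r1' : 0 <= 1 - rv r by rewrite subr_ge0.
rewrite addr_ge0 ?mulr_ge0//=.
rewrite (@le_trans _ _ ((1 - rv r) * 1 + rv r * 1))//; last first.
  by rewrite !mulr1 subrK.
by rewrite lerD// ler_wpM2l.
Qed.

Definition conv01 {R : realType} (s t r : I01 R) : I01 R :=
  mkI01 (conv_itv s t r).

Lemma conv01_continuous {R : realType} (s t : I01 R) :
  continuous (conv01 s t).
Proof.
apply: continuous_comp_initial => r.
have rvc : continuous (rv : I01 R -> R) by exact: initial_continuous.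
have -> : (set_val : I01 R -> R) \o conv01 s t =
    (fun r : I01 R => (1 - rv r) * rv s + rv r * rv t) by [].
have cvr : rv x @[x --> r] --> rv r by exact: rvc.
rewrite /continuous_at.
apply: (@cvgD R R^o (I01 R) (nbhs r)).
- refine (@cvgMr_tmp R (I01 R) (nbhs r) _ (fun x => 1 - rv x) (1 - rv r) (rv s) _).
  by apply: (@cvgB R R^o (I01 R) (nbhs r)); [exact: cvg_cst|exact: cvr].
- exact: (@cvgMr_tmp R (I01 R) (nbhs r) _ rv (rv r) (rv t) cvr).
Qed.

(* C([0,1], X) with the topology of uniform convergence. *)
Definition curve_uniform {R : realType} (X : pmetricType R) : Type :=
  initial_topology
    (id : continuousType (I01 R) X -> {uniform (I01 R) -> X}).

HB.instance Definition _ (R : realType) (X : pmetricType R) :=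
  Topological.copy (curve_uniform X) (initial_topology
    (id : continuousType (I01 R) X -> {uniform (I01 R) -> X})).
HB.instance Definition _ (R : realType) (X : pmetricType R) :=
  isPointed.Build (curve_uniform X)
    (mkcts (@cst_continuous (I01 R) X point)).

Notation curve X := (borel (curve_uniform X)).

Definition ev {R : realType} {X : pmetricType R} (t : I01 R) (g : curve X) :
  borel X := (g : continuousType (I01 R) X) t.

Lemma restr_continuous {R : realType} {X : pmetricType R} (s t : I01 R)
  (g : curve X) :
  continuous ((g : continuousType (I01 R) X) \o conv01 s t : I01 R -> X).
Proof.
move=> r; apply: continuous_comp; first exact: conv01_continuous.
exact: cts_fun.
Qed.

Definition restr {R : realType} {X : pmetricType R} (s t : I01 R)
  (g : curve X) : curve X := mkcts (@restr_continuous R X s t g).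

Section Distances.
Context {R : realType} {X : pmetricType R}.
Implicit Type d : X -> X -> R.

Definition is_distance d : Prop :=
  [/\ forall x y, d x y = 0 <-> x = y,
      forall x y, d x y = d y x &
      forall x y z, d x z <= d x y + d y z].

Definition induces_topology d : Prop :=
  forall (x : X) (A : set X),
    nbhs x A <-> exists2 r, 0 < r & [set y | d x y < r] `<=` A.

Definition curve_dist d (g1 g2 : curve X) : \bar R :=
  ereal_sup (range (fun t => (d (ev t g1) (ev t g2))%:E)).

Definition Geo d : set (curve X) :=
  [set g | forall s t,
    d (ev s g) (ev t g) = `|rv t - rv s| * d (ev I0 g) (ev I1 g)].

End Distances.

Definition polish {R : realType} (X : pmetricType R) : Prop :=
  (exists2 D : set X, countable D & dense D) /\
  (forall u : nat -> X, cauchy (u @ \oo) -> exists x : X, u @ \oo --> x).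

Definition metric_measure_space {R : realType} (X : pmetricType R)
    (m : {measure set (borel X) -> \bar R}) : Prop :=
  [/\ polish X, m setT != 0%E & forall (x : X) (r : R), (m (ball x r) < +oo)%E].

Section Measures.
Context {R : realType}.

(* Elements of [probability T R] are functions on all sets, constrained only on
   the measurable ones: equality of measures must be tested there. *)
Definition same_measure d (T : measurableType d) (mu nu : set T -> \bar R) :
  Prop := forall A, measurable A -> mu A = nu A.

Definition is_probability d (T : measurableType d) (mu : set T -> \bar R) :
  Prop := exists P : probability T R, same_measure mu P.

Definition weighted d (T : measurableType d) (D : set T) (f : T -> R)
  (mu : set T -> \bar R) : set T -> \bar R :=
  fun A => (\int[mu]_(x in A `&` D) (f x)%:E)%E.

Definition is_density d (T : measurableType d) (m mu : set T -> \bar R)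
  (rho : T -> R) : Prop :=
  [/\ measurable_fun setT rho, forall x, 0 <= rho x &
      forall A, measurable A -> mu A = (\int[m]_(x in A) (rho x)%:E)%E].

(* The chosen density exists as soon as [mu `<< m] (Radon-Nikodym), both being
   sigma-finite here; note that [ln 0 = 0]. *)
Definition Ent d (T : measurableType d) (m mu : set T -> \bar R) : \bar R :=
  if `[< mu `<< m >] then
    let rho : T -> R := get (is_density m mu) in
    (\int[m]_x (rho x * ln (rho x))%:E)%E
  else +oo%E.

End Measures.

Section Transport.
Context {R : realType} {X : pmetricType R}.
Implicit Type (d : X -> X -> R) (m mu nu : set (borel X) -> \bar R).
Implicit Type pi : set (borel X * borel X) -> \bar R.

Definition P2 d mu : Prop :=
  is_probability mu /\
  exists x0 : X, (\int[mu]_x (d x x0 ^+ 2)%:E < +oo)%E.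

Definition Pac d m mu : Prop := P2 d mu /\ mu `<< m.

Definition coupling mu nu pi : Prop :=
  [/\ is_probability pi, same_measure (pushforward pi fst) mu &
      same_measure (pushforward pi snd) nu].

Definition cost d pi : \bar R := (\int[pi]_z (d z.1 z.2 ^+ 2)%:E)%E.

Definition W2sq d mu nu : \bar R := ereal_inf (cost d @` coupling mu nu).

Definition OptPlans d mu nu : set (set (borel X * borel X) -> \bar R) :=
  [set pi | coupling mu nu pi /\
    forall pi', coupling mu nu pi' -> (cost d pi <= cost d pi')%E].

Definition OptGeo d mu nu : set (probability (curve X) R) :=
  [set eta | {ae eta, forall g, Geo d g} /\
    OptPlans d mu nu (pushforward eta (fun g => (ev I0 g, ev I1 g)))].

(* The push-forward of f eta by restr_s^t; f matters only on Geo(X). *)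
Definition restricted_plan d (eta : probability (curve X) R)
    (f : curve X -> R) (s t : I01 R) : set (curve X) -> \bar R :=
  pushforward (weighted (Geo d) f eta) (restr s t).

Definition at_time (t : I01 R) (sigma : set (curve X) -> \bar R) :
  set (borel X) -> \bar R := pushforward sigma (ev t).

Definition very_strict_CD d m (K : R) : Prop :=
  forall mu0 mu1 : probability (borel X) R, Pac d m mu0 -> Pac d m mu1 ->
  exists2 eta : probability (curve X) R, OptGeo d mu0 mu1 eta &
    forall s0 s1 : I01 R, rv s0 < rv s1 ->
    forall f : curve X -> R,
      measurable_fun (Geo d) f ->
      (forall g, Geo d g -> 0 <= f g) ->
      (exists M, forall g, Geo d g -> f g <= M) ->
      (\int[eta]_(g in Geo d) (f g)%:E = 1)%E ->
    let sigma := restricted_plan d eta f s0 s1 in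
    forall t : I01 R,
      (Ent m (at_time t sigma) <=
        (1 - rv t)%:E * Ent m (at_time I0 sigma)
        + (rv t)%:E * Ent m (at_time I1 sigma)
        - (K / 2 * rv t * (1 - rv t))%:E
          * W2sq d (at_time I0 sigma) (at_time I1 sigma))%E.

Definition consistent_geodesic_flow d (G : borel X * borel X -> curve X) :
  Prop :=
  [/\ measurable_fun setT G,
      forall x y, [/\ Geo d (G (x, y)), ev I0 (G (x, y)) = x &
                      ev I1 (G (x, y)) = y] &
      forall (s t : I01 R) x y, 0 < rv s -> rv s < rv t -> rv t < 1 ->
        restr s t (G (x, y)) = G (ev s (G (x, y)), ev t (G (x, y)))].

Definition lipschitz_flow d (L : R) (G : borel X * borel X -> curve X) :
  Prop :=
  forall x1 y1 x2 y2,
    (curve_dist d (G (x1, y1)) (G (x2, y2)) <=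
      (L * Num.sqrt (d x1 x2 ^+ 2 + d y1 y2 ^+ 2))%:E)%E.

Definition flow_at (t : I01 R) (G : borel X * borel X -> curve X) :
  borel X * borel X -> borel X := fun z => ev t (G z).

(* [Pi] only matters on pairs of elements of P_ac. In the consistency
   condition, [mu'] and [nu'] are the measures (G_s)_#(f Pi), (G_t)_#(f Pi). *)
Definition consistent_plan_selection d m
    (G : borel X * borel X -> curve X)
    (Pi : probability (borel X) R -> probability (borel X) R ->
          probability (borel X * borel X)%type R) : Prop :=
  (forall mu nu : probability (borel X) R, Pac d m mu -> Pac d m nu ->
     OptPlans d mu nu (Pi mu nu)) /\
  (forall mu nu : probability (borel X) R, Pac d m mu -> Pac d m nu ->
     forall s t : I01 R, rv s < rv t ->
     forall f : borel X * borel X -> R,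
       measurable_fun setT f -> (forall z, 0 <= f z) ->
       (exists M, forall z, f z <= M) ->
       (\int[Pi mu nu]_z (f z)%:E = 1)%E ->
     let fPi := weighted setT f (Pi mu nu) in
     forall mu' nu' : probability (borel X) R,
       same_measure (pushforward fPi (flow_at s G)) mu' ->
       same_measure (pushforward fPi (flow_at t G)) nu' ->
       Pac d m mu' -> Pac d m nu' ->
     same_measure (pushforward fPi (fun z => (flow_at s G z, flow_at t G z)))
                  (Pi mu' nu')).

Definition weak_cvg
    (pi_ : nat -> probability (borel X * borel X)%type R)
    (pi : probability (borel X * borel X)%type R) : Prop :=
  forall f : X * X -> R, continuous f -> (exists M, forall z, `|f z| <= M) ->
    (\int[pi_ n]_z (f z)%:E)%E @[n --> \oo] --> (\int[pi]_z (f z)%:E)%E.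

End Transport.

(* Main.v *)
Require Import Defs.
From HB Require Import structures.
From mathcomp Require Import all_boot all_order all_algebra.
From mathcomp Require Import all_classical all_reals all_analysis.
From mathcomp Require Import measurable_realfun ring lra.
Set Implicit Arguments.
Unset Strict Implicit.
Unset Printing Implicit Defensive.
Import Order.TTheory GRing.Theory Num.Theory.
Import numFieldNormedType.Exports.
Local Open Scope classical_set_scope.
Local Open Scope ring_scope.

(** Why the theorem holds.

    Given [mu0] and [mu1], the geodesic plan is [eta := G_# Pi(mu0, mu1)].  Let
    [f] be a density on it, [s0 < s1] two times, and [F := f o G].  At time [t]
    the restricted plan is the image of [F Pi(mu0, mu1)] under [G_r], where
    [r = (1 - t) s0 + t s1].  When both endpoint measures [mu] and [nu] have
    finite entropy they belong to P_ac, so the consistency of [Pi] identifies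
    [(G_s0, G_s1)_#(F Pi(mu0, mu1))] with [Pi(mu, nu)], and the consistency of
    [G] gives [G_t o (G_s0, G_s1) = G_r].  The measure at time [t] is therefore
    [(G_t)_# Pi(mu, nu)].  The hypothesis provides [d_n]-optimal plans [pi_n]
    that converge weakly to [Pi(mu, nu)] and along which the entropy is
    [K]-convex, and it remains to pass to the limit (lemma
    [Ent_convexity_limit]).  When an endpoint has infinite entropy, the right
    hand side is infinite for [0 < t < 1], and the inequality is an equality at
    [t = 0] and [t = 1].

    Passing to the limit takes three facts.
    - [(G_n)_t # pi_n] converges to [(G_t)_# Pi(mu, nu)] when tested on bounded
      Lipschitz functions ([flow_weak_cvg]): [G_n] is uniformly close to [G],
      and [G_t] is continuous.
    - The transport costs converge ([cvg_W2sq]): [d_n ^ 2] is uniformly close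
      to [d ^ 2] and the set of couplings does not depend on the distance.
    - The entropy relative to the finite measure [m] is lower semicontinuous
      ([Ent_lsc]).  This rests on the dual formula
      [Ent m P = sup_phi (int phi dP - int e^(phi - 1) dm)].  Young's
      inequality [p r <= r ln r + e^(p - 1)] gives one half
      ([integral_le_Ent]).  The other half ([Ent_le_dual]) uses bounded
      measurable [phi] close to [1 + ln rho], where [rho] is the density.  Each
      bracket is continuous in [P] only for regular [phi], so the two halves
      are linked by the density of bounded Lipschitz functions in L^1
      ([bounded_lipschitz_dense]).

    The condition [restr s t (G z) = G (G_s z, G_t z)] is assumed for times in
    the open interval only; it reaches the closed interval because geodesics
    are Lipschitz in time and [G] is Lipschitz ([flow_consistent]). *)

(** * Borel measurability and bounded functions *)

Section Borel.
Context {R : realType}.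

Lemma continuous_borel_measurable (S T : ptopologicalType) (f : S -> T) :
  continuous f -> measurable_fun setT (f : borel S -> borel T).
Proof.
move=> /continuousP cf; apply: (@measurability _ _ (borel S) (borel T) _ _ (@open T)) => //.
by move=> _ [B oB <-]; rewrite setTI; apply: sub_sigma_algebra; exact: cf.
Qed.

Lemma continuous_borel_measurableR (S : ptopologicalType) (f : S -> R) :
  continuous f -> measurable_fun setT (f : borel S -> R).
Proof.
move=> /continuousP cf; apply: (measurability _ (RGenOpens.measurableE R)).
move=> _ [_ [a [b ->] <-]]; rewrite setTI; apply: sub_sigma_algebra.
exact/cf/interval_open.
Qed.

Lemma bounded_integrable d (T : measurableType d)
    (nu : {finite_measure set T -> \bar R}) (f : T -> R) (M : R) :
  measurable_fun setT f -> (forall x, `|f x| <= M) ->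
  nu.-integrable setT (EFin \o f).
Proof.
move=> mf fM; apply: measurable_bounded_integrable => //.
  by rewrite ltey_eq fin_num_measure.
exists M; split; first exact: num_real.
by move=> N MN x _ /=; apply: le_trans (fM x) (ltW MN).
Qed.

End Borel.

(** * Bounded Lipschitz functions on a metric space *)

Section Lipschitz.
Context {R : realType} {X : pmetricType R}.
Implicit Types f g : X -> R.

(** One constant bounds both the function and its slope, which keeps the
    closure lemmas free of case distinctions. *)
Definition bounded_lipschitz f : Prop :=
  exists C, (forall x, `|f x| <= C) /\
            (forall x y, `|f x - f y| <= C * mdist x y).

Definition contraction (h : R -> R) : Prop :=
  forall s t, `|h s - h t| <= `|s - t|.

Lemma contraction_norm : contraction (fun t : R => `|t|).
Proof. by move=> s t; exact: ler_dist_dist. Qed.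

Definition clamp (M t : R) : R := Num.max (- M) (Num.min M t).

(** Truncation does not increase distances, so clamping an approximant of a
    function bounded by [M] costs nothing in L1. *)
Lemma contraction_clamp M : contraction (clamp M).
Proof.
move=> s t; wlog st : s t / t <= s.
  move=> H; have [/H//|/ltW/H] := leP t s.
  by rewrite [in leRHS]distrC [in leLHS]distrC.
rewrite (ger0_norm (_ : 0 <= s - t)) ?subr_ge0// ler_norml /clamp /Num.max /Num.min.
by repeat case: ifPn => /=; rewrite -?leNgt => *; lra.
Qed.

Lemma lipschitz_continuous f C :
  (forall x y, `|f x - f y| <= C * mdist x y) -> continuous f.
Proof.
move=> fC x; apply/cvgrPdist_lt => e e0.
have C1 : 0 < `|C| + 1 by rewrite ltr_wpDl.
apply/metricType_numDomainType.nbhs_mdistP; exists (e / (`|C| + 1)) => /=; first exact: divr_gt0.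
move=> y /=; rewrite ltr_pdivlMr// => xy; rewrite (le_lt_trans (fC x y))//.
rewrite (le_lt_trans _ xy)// mulrC ler_wpM2l ?mdist_ge0//.
by rewrite (le_trans (ler_norm C))// lerDl.
Qed.

Lemma bounded_lipschitz_continuous f : bounded_lipschitz f -> continuous f.
Proof. by move=> [C [_ /lipschitz_continuous]]. Qed.

Lemma bounded_lipschitz_lin a f g : bounded_lipschitz f ->
  bounded_lipschitz g -> bounded_lipschitz (fun x => a * f x + g x).
Proof.
move=> [C [fC fL]] [D [gD gL]]; exists (`|a| * C + D); split => [x|x y].
  rewrite (le_trans (ler_normD _ _))// lerD// normrM.
  by rewrite ler_wpM2l.
have -> : a * f x + g x - (a * f y + g y) = a * (f x - f y) + (g x - g y).
  by ring.
rewrite (le_trans (ler_normD _ _))// mulrDl lerD// normrM -mulrA.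
by rewrite ler_wpM2l.
Qed.

Lemma bounded_lipschitz_cst (c : R) : bounded_lipschitz (fun=> c).
Proof.
exists `|c|; split => // x y.
by rewrite subrr normr0 mulr_ge0// mdist_ge0.
Qed.

Lemma bounded_lipschitz_contraction h f : contraction h -> bounded_lipschitz f ->
  bounded_lipschitz (h \o f).
Proof.
move=> hc [C [fC fL]]; have C0 : 0 <= C by exact: le_trans (fC point).
exists (C + `|h 0|); split => [x|x y] /=.
  rewrite -[h (f x)](subrK (h 0)) (le_trans (ler_normD _ _))// lerD2r.
  by rewrite (le_trans (hc _ _))// subr0.
rewrite (le_trans (hc _ _))// (le_trans (fL _ _))//.
by rewrite ler_wpM2r ?mdist_ge0// lerDl.
Qed.

Lemma clamp_le M t : 0 <= M -> `|clamp M t| <= M.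
Proof.
move=> M0; rewrite ler_norml /clamp /Num.max /Num.min.
by repeat case: ifPn => /=; rewrite -?leNgt => *; lra.
Qed.

Lemma clamp_id M t : `|t| <= M -> clamp M t = t.
Proof.
rewrite ler_norml /clamp /Num.max /Num.min => /andP[].
by repeat case: ifPn => /=; rewrite -?leNgt => *; lra.
Qed.

Lemma bounded_lipschitz_clamp f C M : 0 <= M ->
  (forall x y, `|f x - f y| <= C * mdist x y) -> bounded_lipschitz (clamp M \o f).
Proof.
move=> M0 fC; exists (M + `|C|); split => [x|x y] /=.
  by rewrite (le_trans (clamp_le _ _))// lerDl.
rewrite (le_trans (contraction_clamp _ _ _))// (le_trans (fC _ _))//.
by rewrite ler_wpM2r ?mdist_ge0// (le_trans (ler_norm C))// lerDr.
Qed.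

(** On the empty set the infimum is [0] by convention, hence the nonemptiness in
    [dist_to_gt0]. *)
Definition dist_to (A : set X) (x : X) : R := inf [set mdist x a | a in A].

Lemma dist_to_has_lbound (A : set X) x : has_lbound [set mdist x a | a in A].
Proof. by exists 0 => _ [a _ <-]; exact: mdist_ge0. Qed.

Lemma dist_to_lipschitz A x y : A !=set0 ->
  `|dist_to A x - dist_to A y| <= 1 * mdist x y.
Proof.
move=> [a0 Aa0].
suff H u v : dist_to A u - dist_to A v <= mdist u v.
  by rewrite mul1r ler_norml H andbT lerNl opprB metric_sym H.
rewrite lerBlDr -lerBlDl; apply: lb_le_inf; first by exists (mdist v a0), a0.
move=> _ [a Aa <-]; rewrite lerBlDl.
rewrite (le_trans _ (metric_triangle u v a))//.
by apply: ge_inf; [exact: dist_to_has_lbound|exists a].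
Qed.

Lemma dist_to_eq0 A x : A x -> dist_to A x = 0.
Proof.
move=> Ax; apply/le_anti/andP; split.
  by apply: ge_inf; [exact: dist_to_has_lbound|exists x => //; rewrite mdistxx].
apply: lb_le_inf; first by exists (mdist x x), x.
by move=> _ [a _ <-]; exact: mdist_ge0.
Qed.

Lemma dist_to_gt0 A x : A !=set0 -> open (~` A) -> ~ A x -> 0 < dist_to A x.
Proof.
move=> [a0 Aa0] oA nAx.
have /metricType_numDomainType.nbhs_mdistP[e /= e0 xeA] : nbhs x (~` A) by exact: open_nbhs_nbhs.
rewrite (lt_le_trans e0)//; apply: lb_le_inf; first by exists (mdist x a0), a0.
move=> _ [a Aa <-]; rewrite leNgt; apply/negP => xa.
exact: (xeA a xa).
Qed.

End Lipschitz.

(** * Density of bounded Lipschitz functions in L1 *)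

Lemma cvge_near_lt {R : realType} (u : nat -> \bar R) (x y : \bar R) :
  u n @[n --> \oo] --> x -> (x < y)%E -> \forall n \near \oo, (u n < y)%E.
Proof. by move=> ux xy; apply: ux (open_ereal_lt' xy). Qed.

Section L1density.
Context {R : realType} {X : pmetricType R}
  (nu : {finite_measure set (borel X) -> \bar R}).
Implicit Types f g h : borel X -> R.

Definition L1dist f g : \bar R := (\int[nu]_x (`|f x - g x|)%:E)%E.

(** The class of functions in the L1 closure of the bounded Lipschitz functions.
    It is a vector space, stable under contractions and under bounded pointwise
    limits; this is enough to climb from open sets to measurable functions. *)
Definition lip_approximable f : Prop := measurable_fun setT f /\
  forall e : R, 0 < e -> exists2 g, bounded_lipschitz (g : X -> R) &
    (L1dist f g <= e%:E)%E.

Lemma bounded_lipschitz_measurable f : bounded_lipschitz (f : X -> R) ->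
  measurable_fun setT f.
Proof.
by move=> /bounded_lipschitz_continuous; exact: continuous_borel_measurableR.
Qed.

Lemma measurable_abs_sub f g : measurable_fun setT f -> measurable_fun setT g ->
  measurable_fun setT (EFin \o (fun x => `|f x - g x|)).
Proof.
move=> mf mg; apply/measurable_EFinP; apply: measurableT_comp => //.
exact: measurable_funB.
Qed.

Lemma L1dist_lin (a : R) f g f' g' : measurable_fun setT f -> measurable_fun setT g ->
  measurable_fun setT f' -> measurable_fun setT g' ->
  (L1dist (fun x => a * f x + g x)%R (fun x => a * f' x + g' x)%R <=
    `|a|%:E * L1dist f f' + L1dist g g')%E.
Proof.
move=> mf mg mf' mg'; rewrite /L1dist.
have mff' := measurable_abs_sub mf mf'; have mgg' := measurable_abs_sub mg mg'.
rewrite -ge0_integralZl//= -ge0_integralD//=; last first.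
  by apply: measurable_funeM.
apply: ge0_le_integral => //=.
- by apply: measurable_abs_sub; apply: measurable_funD => //; apply: measurable_funM.
- by apply: emeasurable_funD => //; apply: measurable_funeM.
- move=> x _; rewrite -EFinM -EFinD lee_fin -normrM.
  rewrite (_ : _ - _ = a * (f x - f' x) + (g x - g' x)); last by ring.
  exact: ler_normD.
Qed.

Lemma L1dist_triangle g f h : measurable_fun setT f -> measurable_fun setT g ->
  measurable_fun setT h -> (L1dist f h <= L1dist f g + L1dist g h)%E.
Proof.
move=> mf mg mh; rewrite /L1dist -ge0_integralD//; last 2 first.
- exact: measurable_abs_sub.
- exact: measurable_abs_sub.
apply: ge0_le_integral => //.
- exact: measurable_abs_sub.
- by apply: emeasurable_funD; exact: measurable_abs_sub.
- by move=> x _; rewrite -EFinD lee_fin; exact: ler_distD.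
Qed.

Lemma lip_approximable_base f : bounded_lipschitz (f : X -> R) ->
  lip_approximable f.
Proof.
move=> fL; split; first exact: bounded_lipschitz_measurable.
move=> e e0; exists f => //; rewrite /L1dist.
under eq_integral do rewrite subrr normr0.
by rewrite integral0 lee_fin ltW.
Qed.

Lemma lip_approximable_lin a f g : lip_approximable f -> lip_approximable g ->
  lip_approximable (fun x => a * f x + g x).
Proof.
move=> [mf fP] [mg gP]; split.
  by apply: measurable_funD => //; exact: measurable_funM.
move=> e e0; have a1 : 0 < `|a| + 1 by rewrite ltr_wpDl.
have [f' f'L ff'] : exists2 f', bounded_lipschitz (f' : X -> R) &
    (L1dist f f' <= (e / (`|a| + 1) / 2)%:E)%E by apply: fP; rewrite !divr_gt0.
have [g' g'L gg'] : exists2 g', bounded_lipschitz (g' : X -> R) &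
    (L1dist g g' <= (e / 2)%:E)%E by apply: gP; rewrite divr_gt0.
exists (fun x => a * f' x + g' x); first exact: bounded_lipschitz_lin.
rewrite (le_trans (L1dist_lin _ _ _ _ _))//; try exact: bounded_lipschitz_measurable.
apply: (@le_trans _ _ (`|a| * (e / (`|a| + 1) / 2) + e / 2)%:E).
  by rewrite EFinD EFinM; apply: leeD => //; apply: lee_wpmul2l; rewrite ?lee_fin.
rewrite lee_fin.
rewrite (_ : _ + _ = e * (`|a| / (`|a| + 1) + 1) / 2); last by field; rewrite gt_eqF.
have aa : `|a| / (`|a| + 1) <= 1 by rewrite ler_pdivrMr// mul1r lerDl.
rewrite ler_pdivrMr//; apply: ler_wpM2l; first exact: ltW.
by rewrite -lerBrDr (le_trans aa)//; lra.
Qed.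

Lemma L1dist_contraction (h : R -> R) f g : contraction h -> measurable_fun setT (h : R -> R) ->
  measurable_fun setT f -> measurable_fun setT g ->
  (L1dist (h \o f) (h \o g) <= L1dist f g)%E.
Proof.
move=> hc mh mf mg; apply: ge0_le_integral => //.
- by apply: measurable_abs_sub; exact: measurableT_comp.
- exact: measurable_abs_sub.
- by move=> x _; rewrite lee_fin; exact: hc.
Qed.

Lemma contraction_measurable (h : R -> R) : contraction h -> measurable_fun setT h.
Proof.
move=> hc; apply: continuous_measurable_fun => x.
apply/cvgrPdist_lt => e e0; near=> y.
rewrite (le_lt_trans (hc _ _))//; near: y.
Unshelve. all: by end_near. Qed.

Lemma lip_approximable_contraction (h : R -> R) f : contraction h -> lip_approximable f ->
  lip_approximable (h \o f).
Proof.
move=> hc [mf fP]; have mh := contraction_measurable hc.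
split; first exact: measurableT_comp.
move=> e e0; have [g gL fg] := fP e e0; exists (h \o g).
  exact: bounded_lipschitz_contraction.
rewrite (le_trans _ fg)// L1dist_contraction//.
exact: bounded_lipschitz_measurable.
Qed.

(** Uses [max f g = (f + g + |g - f|) / 2]. *)
Lemma lip_approximable_max f g : lip_approximable f -> lip_approximable g ->
  lip_approximable (fun x => Num.max (f x) (g x)).
Proof.
move=> fV gV; have V0 := lip_approximable_base (bounded_lipschitz_cst 0).
have VB := lip_approximable_lin (-1) gV fV.
have VN := lip_approximable_contraction contraction_norm VB.
have := lip_approximable_lin (2^-1) (lip_approximable_lin 1 VN
  (lip_approximable_lin 1 fV gV)) V0.
congr lip_approximable; apply/funext => x /=.
rewrite /Num.max; case: ifPn; rewrite -?leNgt => xy.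
  by rewrite ltr0_norm; lra.
by rewrite ger0_norm; lra.
Qed.

(** By dominated convergence, a bounded pointwise limit is an L1 limit because
    the measure is finite. *)
Lemma lip_approximable_lim (f_ : nat -> borel X -> R) f M :
  (forall n, lip_approximable (f_ n)) -> (forall n x, `|f_ n x| <= M) ->
  (forall x, f_ n x @[n --> \oo] --> f x) -> lip_approximable f.
Proof.
move=> fV fM ff.
have mf_ n : measurable_fun setT (f_ n) by case: (fV n).
have mf : measurable_fun setT f.
  by apply: (measurable_fun_cvg mf_) => x _; exact: ff.
split => // e e0.
have [] := @dominated_convergence _ _ _ nu setT measurableT
  (fun n => EFin \o f_ n) (EFin \o f) (cst M%:E).
- by move=> n; exact/measurable_EFinP.
- exact/measurable_EFinP.
- by apply: aeW => x _; apply: cvg_EFin; [exact: nearW|exact: ff].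
- exact: (@bounded_integrable _ _ _ _ (cst M) `|M|).
- by apply: aeW => x n _; rewrite lee_fin.
move=> _ f0 _; have e2 : 0 < e / 2 by rewrite divr_gt0.
have : (0 < (e / 2)%:E)%E by rewrite lte_fin.
move=> /(cvge_near_lt f0)[n _ /(_ n (leqnn n))/ltW ffn].
have [g gL fg] := (fV n).2 _ e2; exists g => //.
have mg := bounded_lipschitz_measurable gL.
rewrite (le_trans (L1dist_triangle mf (mf_ n) mg))// (splitr e) EFinD leeD//.
rewrite (le_trans _ ffn)// le_eqVlt; apply/orP; left; apply/eqP.
by apply: eq_integral => x _ /=; rewrite distrC.
Qed.

(** The indicator of an open set is the increasing limit of the truncations at
    [1] of [n] times the distance to the complement. *)
Lemma lip_approximable_open (U : set X) : open U ->
  lip_approximable (\1_U : borel X -> R).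
Proof.
move=> oU; have [CU0|/set0P CU] := eqVneq (~` U) set0.
  apply: lip_approximable_base; rewrite (_ : U = setT) ?indicT.
    exact: bounded_lipschitz_cst.
  by rewrite -(setCK U) CU0 setC0.
(* These functions vanish outside [U] and eventually reach [1] at each point of [U]. *)
pose f_ n x := clamp 1 (n%:R * dist_to (~` U) x).
apply: (@lip_approximable_lim f_ _ 1).
- move=> n; apply: lip_approximable_base.
  apply: (@bounded_lipschitz_clamp _ _ _ n%:R) => // x y.
  rewrite -mulrBr normrM ger0_norm// ler_wpM2l//.
  by rewrite (le_trans (dist_to_lipschitz _ _ CU))// mul1r.
- by move=> n x; exact: clamp_le.
- move=> x; have [Ux|nUx] := pselect (U x); last first.
    rewrite (_ : f_ ^~ x = cst 0) ?indicE ?memNset//; first exact: cvg_cst.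
    apply/funext => n; rewrite /f_ dist_to_eq0// mulr0 clamp_id//.
    by rewrite normr0.
  have d0 : 0 < dist_to (~` U) x by apply: dist_to_gt0; rewrite ?setCK//; exact.
  rewrite indicE mem_set//; apply: cvg_near_cst.
  near=> n; rewrite /f_ /clamp; have : 1 <= n%:R * dist_to (~` U) x.
    rewrite -ler_pdivrMr//; near: n; exact: nbhs_infty_ger.
  by move=> h; rewrite min_l// max_r// lerNl.
Unshelve. all: by end_near. Qed.

(** The sets with an approximable indicator form a sigma-algebra: complements
    are affine images, finite unions are maxima and countable unions are limits.
    It contains the open sets. *)
Lemma lip_approximable_indic (A : set (borel X)) : measurable A ->
  lip_approximable (\1_A : borel X -> R).
Proof.
have ind0 : lip_approximable (\1_(set0 : set (borel X)) : borel X -> R).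
  exact: lip_approximable_open open0.
suff : @measurable _ (borel X) `<=` [set A | lip_approximable (\1_A : borel X -> R)].
  by move=> H /H.
apply: smallest_sub; last by move=> U oU; exact: lip_approximable_open.
split => //.
- move=> E EV /=.
  have := lip_approximable_lin (-1) EV (lip_approximable_base (bounded_lipschitz_cst 1)).
  congr lip_approximable; apply/funext => x; rewrite !indicE in_setD in_setT/=.
  by case: (x \in E) => /=; lra.
(* The partial unions exhaust the countable union. *)
- move=> F FV /=; pose B n := \big[setU/set0]_(i < n) F i.
  apply: (@lip_approximable_lim (fun n => \1_(B n)) _ 1).
  + elim => [|n IH]; first by rewrite /B big_ord0.
    rewrite /B big_ord_recr/=; have := lip_approximable_max IH (FV n).
    congr lip_approximable; apply/funext => x; rewrite !indicE in_setU.
    by case: (x \in F n); case: (_ \in _) => /=;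
      rewrite /Num.max; case: ifP => //=; lra.
  + by move=> n x; rewrite indicE; case: (_ \in _); rewrite ?normr1 ?normr0.
  + move=> x; have [[n _ Fnx]|nFx] := pselect ((\bigcup_i F i) x).
      rewrite indicE mem_set; last by exists n.
      apply: cvg_near_cst; near=> k; rewrite indicE mem_set//.
      rewrite /B -bigcup_mkord; exists n => //=; near: k.
      exact: nbhs_infty_gt.
    rewrite (_ : (fun n => _) = cst 0); first by rewrite indicE memNset//; exact: cvg_cst.
    apply/funext => n; rewrite indicE memNset// /B -bigcup_mkord => -[i _ Fix].
    by apply: nFx; exists i.
Unshelve. all: by end_near. Qed.

Import HBNNSimple.

(** After a translation the function is nonnegative, hence a bounded limit of
    simple functions. *)
Lemma lip_approximable_bounded f (M : R) : measurable_fun setT f ->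
  (forall x, `|f x| <= M) -> lip_approximable f.
Proof.
move=> mf fM; have fM0 x : 0 <= f x + M.
  by have := fM x; rewrite ler_norml => /andP[]; lra.
suff : lip_approximable (fun x => f x + M).
  move=> /(lip_approximable_lin 1)/(_ (lip_approximable_base (bounded_lipschitz_cst (- M)))).
  by congr lip_approximable; apply/funext => x; rewrite mul1r addrK.
have mg : measurable_fun setT (EFin \o (fun x => f x + M)).
  by apply/measurable_EFinP; exact: measurable_funD.
pose s_ := nnsfun_approx measurableT mg.
have sV (s : {nnsfun borel X >-> R}) : lip_approximable s.
  suff sum_V n (a : nat -> R) (F : nat -> borel X -> R) :
      (forall i, lip_approximable (F i)) ->
      lip_approximable (fun x => \sum_(i < n) a i * F i x).
    pose t : seq R := finmap.enum_fset (fset_set (range s)).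
    have -> : (s : borel X -> R) =
        fun x => \sum_(i < size t) t`_i * \1_(s @^-1` [set t`_i]) x.
      by apply/funext => x; exact: (fimfunEord s).
    have H := sum_V (size t) (fun i => t`_i) (fun i => \1_(s @^-1` [set t`_i])).
    by apply: H => i; exact: lip_approximable_indic.
  move=> FV; elim: n => [|n IH].
    rewrite (_ : (fun x => _) = cst 0).
      exact: lip_approximable_base (bounded_lipschitz_cst 0).
    by apply/funext => x; rewrite big_ord0.
  have := lip_approximable_lin (a n) (FV n) IH.
  by congr lip_approximable; apply/funext => x; rewrite big_ord_recr/= addrC.
have s_cvg x : s_ n x @[n --> \oo] --> f x + M.
  have := @cvg_nnsfun_approx _ _ _ _ measurableT _ mg (fun x _ => fM0 x) x I.
  by move=> /fine_cvgP[_].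
apply: (@lip_approximable_lim s_ _ (`|M| + `|M|)) => // n x.
rewrite ger0_norm; last exact: fun_ge0.
have := @le_approx _ _ _ setT (EFin \o (fun x => f x + M)) n x (fun x _ => fM0 x) I.
rewrite /s_ nnsfun_approxE lee_fin => /le_trans; apply.
by rewrite lerD// (le_trans _ (ler_norm _))// (le_trans (ler_norm _) (fM x)).
Qed.

(** The approximant obeys the same bound as [f]; exponentials of approximants are
    then controlled uniformly. *)
Lemma bounded_lipschitz_dense f (M : R) : measurable_fun setT f ->
  (forall x, `|f x| <= M) -> forall e : R, 0 < e ->
  exists g, [/\ bounded_lipschitz (g : X -> R), forall x, `|g x| <= M &
    (L1dist f g <= e%:E)%E].
Proof.
move=> mf fM e e0; have [_ /(_ e e0)[g gL fg]] := lip_approximable_bounded mf fM.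
have M0 : 0 <= M by exact: le_trans (fM point).
exists (clamp M \o g); split.
- exact: bounded_lipschitz_contraction (@contraction_clamp _ M) gL.
- by move=> x; exact: clamp_le.
rewrite (_ : f = clamp M \o f); last by apply/funext => x /=; rewrite clamp_id.
rewrite (le_trans (L1dist_contraction _ _ _ _))//.
- exact: contraction_clamp.
- exact: contraction_measurable (@contraction_clamp _ M).
- exact: bounded_lipschitz_measurable gL.
Qed.

End L1density.

(** * The dual formula for the entropy *)

Section Entropy.
Context {R : realType} d {T : measurableType d}.
Implicit Types (m : {finite_measure set T -> \bar R}) (rho phi : T -> R).

(** Young's inequality for the conjugate pair [r ln r] and [e^(p - 1)]; it is
    [1 + u <= e^u] at [u = p - 1 - ln r], multiplied by [r]. *)
Lemma mul_ln_expR_ge (r p : R) : 0 <= r -> p * r <= r * ln r + expR (p - 1).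
Proof.
rewrite le_eqVlt => /predU1P[<-|r0].
  by rewrite mulr0 mul0r add0r expR_ge0.
have -> : expR (p - 1) = r * expR (p - 1 - ln r).
  by rewrite expRB lnK ?posrE// mulrCA divff ?mulr1// gt_eqF.
have := expR_ge1Dx (p - 1 - ln r) => h.
have : r * (1 + (p - 1 - ln r)) <= r * expR (p - 1 - ln r) by rewrite ler_wpM2l// ltW.
lra.
Qed.

Lemma mul_ln_ge (r : R) : 0 <= r -> r - 1 <= r * ln r.
Proof.
move=> r0; have := mul_ln_expR_ge 1 r0.
by rewrite subrr expR0 mul1r lerBlDr.
Qed.

Lemma measurable_mul_ln rho : measurable_fun setT rho ->
  measurable_fun setT (fun x => rho x * ln (rho x)).
Proof.
move=> mrho; apply: measurable_funM => //.
by apply: measurableT_comp => //; exact: measurable_ln.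
Qed.

Lemma measurable_expRB1 phi : measurable_fun setT phi ->
  measurable_fun setT (fun x => expR (phi x - 1)).
Proof.
move=> mphi; apply: measurableT_comp; first exact: measurable_expR.
exact: measurable_funB.
Qed.

(** On a finite measure space the negative part of a function bounded below is
    integrable, so a finite integral controls the positive part as well. *)
Lemma integrable_of_lbound m (h : T -> R) (B : R) : measurable_fun setT h ->
  (forall x, - B <= h x) -> (\int[m]_x (h x)%:E < +oo)%E ->
  m.-integrable setT (EFin \o h).
Proof.
move=> mh hB hoo; have mEh : measurable_fun setT (EFin \o h) by exact/measurable_EFinP.
have B0 : 0 <= `|B| by [].
have negoo : (\int[m]_x ((EFin \o h)^\- x) < +oo)%E.
  rewrite (@le_lt_trans _ _ (\int[m]_x (cst `|B|%:E x))%E)//.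
    apply: ge0_le_integral => //; first exact: measurable_funeneg.
    move=> x _; rewrite funenegE/= -EFin_max lee_fin ge_max B0 andbT.
    by rewrite (le_trans _ (ler_norm B))// lerNl.
  by rewrite integral_cst//= lte_mul_pinfty// ltey_eq fin_num_measure.
have negfin : (\int[m]_x ((EFin \o h)^\- x))%E \is a fin_num.
  by rewrite ge0_fin_numE// integral_ge0.
apply/integrableP; split => //.
have -> : (\int[m]_x `|(EFin \o h) x| =
    \int[m]_x (((EFin \o h)^\+ \+ (EFin \o h)^\-) x))%E by rewrite -fune_abse.
rewrite ge0_integralD//; last 2 first.
- exact: measurable_funepos.
- exact: measurable_funeneg.
rewrite lte_add_pinfty//.
have {}hoo : (\int[m]_x ((EFin \o h) x) < +oo)%E := hoo.
by rewrite integralE -(fineK negfin) lteBlDr in hoo.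
Qed.

(** Set functions are compared on measurable sets only, so a measure may be
    replaced by any set function that agrees with it there. *)
Lemma Ent_ext m (mu nu : set T -> \bar R) : same_measure mu nu ->
  Ent m mu = Ent m nu.
Proof.
move=> mn; rewrite /Ent.
have -> : (mu `<< m) = (nu `<< m).
  apply/propext; rewrite !null_content_dominatesP.
  by split=> H A mA mA0; [rewrite -mn|rewrite mn] => //; exact: H.
have -> // : is_density m mu = is_density m nu.
apply/funext => rho; apply/propext; rewrite /is_density.
by split => -[? ? H]; split => // A mA; rewrite -H// mn.
Qed.

Section FiniteMeasure.
Variables (m P : {finite_measure set T -> \bar R}).

Lemma density_integrable rho : is_density m P rho ->
  m.-integrable setT (EFin \o rho).
Proof.
move=> [mrho rho0 rhoE]; apply/integrableP; split; first exact/measurable_EFinP.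
under eq_integral do rewrite gee0_abs ?lee_fin//.
by rewrite -rhoE// ltey_eq fin_num_measure.
Qed.

Lemma ae_eq_density rho : P `<< m -> is_density m P rho ->
  ae_eq m setT (EFin \o rho) (Radon_Nikodym (charge_of_finite_measure P) m).
Proof.
move=> Pm [mrho rho0 rhoE].
apply: integral_ae_eq => //.
- exact: density_integrable.
- by move=> E _ mE; rewrite -[RHS]Radon_Nikodym_integral//; exact/esym/rhoE.
Qed.

(** The density chosen in the definition of the entropy need not be the
    Radon-Nikodym derivative, but it is almost everywhere equal to it. *)
Lemma integral_density rho phi (M : R) : P `<< m -> is_density m P rho ->
  measurable_fun setT phi -> (forall x, `|phi x| <= M) ->
  (\int[P]_x (phi x)%:E = \int[m]_x (phi x * rho x)%:E)%E.
Proof.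
move=> Pm rhoD mphi phiM; have [mrho _ _] := rhoD.
rewrite -(Radon_Nikodym_change_of_variables Pm)//; last exact: bounded_integrable phiM.
apply: ae_eq_integral => //.
- by apply: emeasurable_funM => //; exact/measurable_EFinP.
- by apply/measurable_EFinP; exact: measurable_funM.
- under [X in ae_eq _ _ _ X]eq_fun do rewrite EFinM.
  apply: (@ae_eqe_mul2l _ _ _ m setT _ _ (EFin \o phi)).
  exact/ae_eq_sym/ae_eq_density.
Qed.

Lemma integrable_density rho phi (M : R) : is_density m P rho ->
  measurable_fun setT phi -> (forall x, `|phi x| <= M) ->
  m.-integrable setT (fun x => (phi x * rho x)%:E).
Proof.
move=> rhoD mphi phiM.
apply: (@integrableMr _ _ _ m setT measurableT phi (EFin \o rho)) => //.
  exists M; split; first exact: num_real.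
  by move=> N MN x _ /=; apply: le_trans (phiM x) (ltW MN).
exact: density_integrable.
Qed.

Lemma EntE : P `<< m ->
  exists2 rho, is_density m P rho & Ent m P = (\int[m]_x (rho x * ln (rho x))%:E)%E.
Proof.
move=> Pm; have [f [f0 ffin intf fE]] := radon_nikodym_sigma_finite Pm.
have fD : is_density m P (fine \o f).
  split.
  - by apply: measurableT_comp => //; exact: (measurable_int m).
  - by move=> x; exact: fine_ge0.
  - by move=> A mA; rewrite fE//; apply: eq_integral => x _; rewrite /= fineK.
exists (get (is_density m P)); first by apply: getPex; exists (fine \o f).
by rewrite /Ent; case: asboolP.
Qed.

Lemma Ent_dominates : (Ent m P < +oo)%E -> P `<< m.
Proof. by rewrite /Ent; case: asboolP. Qed.

Lemma integrable_expRB1 phi (M : R) : measurable_fun setT phi ->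
  (forall x, `|phi x| <= M) ->
  m.-integrable setT (fun x => (expR (phi x - 1))%:E).
Proof.
move=> mphi phiM; apply: (@bounded_integrable _ _ _ _ _ (expR (M - 1))).
  exact: measurable_expRB1.
move=> x; rewrite ger0_norm ?expR_ge0// ler_expR lerD2r.
exact: le_trans (ler_norm _) (phiM x).
Qed.

(** The easy half of duality: Young's inequality integrated against [m]. *)
Lemma integral_le_Ent phi (M : R) : (Ent m P < +oo)%E ->
  measurable_fun setT phi -> (forall x, `|phi x| <= M) ->
  (\int[P]_x (phi x)%:E <= Ent m P + \int[m]_x (expR (phi x - 1))%:E)%E.
Proof.
move=> Pfin mphi phiM; have Pm := Ent_dominates Pfin.
have [rho rhoD EntE] := EntE Pm; have [mrho rho0 _] := rhoD.
have mh := measurable_mul_ln mrho.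
have hi : m.-integrable setT (fun x => (rho x * ln (rho x))%:E).
  apply: (@integrable_of_lbound _ _ 1) => //; last by rewrite -EntE.
  by move=> x; rewrite (le_trans _ (mul_ln_ge (rho0 x)))// lerBrDr addrC subrr.
rewrite EntE (integral_density Pm rhoD mphi phiM) -integralD//; last first.
  exact: integrable_expRB1 phiM.
apply: le_integral => //.
- exact: integrable_density phiM.
- by apply: integrableD => //; exact: integrable_expRB1 phiM.
- by move=> x _; rewrite -EFinD lee_fin mul_ln_expR_ge.
Qed.

(** Follows from [r - 1 <= r ln r], as [m] is finite. *)
Lemma Ent_gtNy : (-oo < Ent m P)%E.
Proof.
have [Pm|] := pselect (P `<< m); last by rewrite /Ent; case: asboolP.
have [rho [mrho rho0 _] ->] := EntE Pm.
apply: (@lt_le_trans _ _ (\int[m]_x (cst (-1)%:E x))%E).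
  rewrite integral_cst//= -(fineK (fin_num_measure m setT measurableT)).
  by rewrite -EFinM ltNyr.
have [|hoo] := leP +oo%E (\int[m]_x (rho x * ln (rho x))%:E)%E.
  by rewrite leye_eq => /eqP ->; rewrite leey.
apply: le_integral => //.
- exact: finite_measure_integrable_cst.
- apply: (@integrable_of_lbound _ _ 1) => //; first exact: measurable_mul_ln.
  by move=> x; rewrite (le_trans _ (mul_ln_ge (rho0 x)))// lerBrDr addrC subrr.
- by move=> x _; rewrite lee_fin (le_trans _ (mul_ln_ge (rho0 x)))// lerBrDr addrC subrr.
Qed.


(** Both bounds are needed to make [ln (truncate k rho)] a bounded test function. *)
Definition truncate (k : nat) (r : R) : R :=
  Num.min (Num.max r k.+1%:R^-1) k.+1%:R.

Let kinv_gt0 (k : nat) : 0 < k.+1%:R^-1 :> R. Proof. by rewrite invr_gt0. Qed.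
Let kinv_le1 (k : nat) : k.+1%:R^-1 <= 1 :> R.
Proof. by rewrite invf_le1// ler1n. Qed.
Let k_ge1 (k : nat) : 1 <= k.+1%:R :> R. Proof. by rewrite ler1n. Qed.

Lemma truncate_gt0 k r : 0 < truncate k r.
Proof. by rewrite lt_min ltr0Sn andbT lt_max kinv_gt0 orbT. Qed.

Lemma truncate_le k r : truncate k r <= k.+1%:R.
Proof. by rewrite ge_min lexx orbT. Qed.

Lemma truncate_ge k r : k.+1%:R^-1 <= truncate k r.
Proof. by rewrite le_min le_max lexx orbT/= (le_trans (kinv_le1 k)). Qed.

Lemma ln_truncate_le k r : `|ln (truncate k r)| <= ln k.+1%:R.
Proof.
rewrite ler_norml ler_ln ?posrE ?truncate_gt0// truncate_le andbT.
by rewrite -lnV ?posrE// ler_ln ?posrE ?truncate_gt0// truncate_ge.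
Qed.

(** A lower bound independent of [k] is what Fatou's lemma requires. *)
Lemma truncate_lbound k r : 0 <= r ->
  - 2 <= (1 + ln (truncate k r)) * r - truncate k r.
Proof.
move=> r0; have [r1|r1] := leP 1 r.
  have y1 : 1 <= truncate k r by rewrite le_min k_ge1 le_max r1.
  have yr : truncate k r <= r.
    by rewrite ge_min ge_max lexx (le_trans (kinv_le1 k)).
  have ly : 0 <= ln (truncate k r) by rewrite ln_ge0.
  have := mulr_ge0 ly r0; lra.
have y1 : truncate k r <= 1 by rewrite ge_min ge_max (ltW r1) kinv_le1.
have ry : r <= truncate k r.
  by rewrite le_min le_max lexx/= (le_trans (ltW r1)).
have : r * ln r <= r * ln (truncate k r).
  move: r0; rewrite le_eqVlt => /predU1P[<-|r0]; first by rewrite !mul0r.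
  by rewrite ler_pM2l// ler_ln ?posrE ?truncate_gt0.
have := mul_ln_ge r0; lra.
Qed.

(** For [r > 0] the sequence is eventually constant; for [r = 0] it is
    [- 1 / (k + 1)]. *)
Lemma cvg_truncate r : 0 <= r ->
  (1 + ln (truncate k r)) * r - truncate k r @[k --> \oo] --> r * ln r.
Proof.
rewrite le_eqVlt => /predU1P[<-|r0].
  rewrite mul0r (_ : (fun k => _) = fun k => - harmonic k).
    by rewrite -[X in _ --> X]oppr0; apply: cvgN; exact: cvg_harmonic.
  apply/funext => k; rewrite mulr0 sub0r /truncate /harmonic/= max_r ?ltW//.
  by rewrite min_l// (le_trans (kinv_le1 k)).
apply: cvg_near_cst; near=> k.
have -> : truncate k r = r; last by lra.
have rk : r <= k.+1%:R.
  near: k; apply: filterS (nbhs_infty_ger r) => k /le_trans; apply.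
  by rewrite ler_nat.
have kr : k.+1%:R^-1 <= r.
  rewrite -[leRHS]invrK lef_pV2 ?posrE ?invr_gt0//.
  near: k; apply: filterS (nbhs_infty_ger r^-1) => k /le_trans; apply.
  by rewrite ler_nat.
by rewrite /truncate max_l// min_l.
Unshelve. all: by end_near. Qed.

Lemma measurable_truncate k rho : measurable_fun setT rho ->
  measurable_fun setT (fun x => truncate k (rho x)).
Proof.
move=> mrho; apply: measurable_minr; last exact: measurable_cst.
by apply: measurable_maxr => //; exact: measurable_cst.
Qed.

Lemma limn_einf_le (u : nat -> \bar R) (x : \bar R) :
  (forall n, (u n <= x)%E) -> (limn_einf u <= x)%E.
Proof.
move=> ux; rewrite limn_einf_lim; apply: lime_le; first exact: is_cvg_einfs.
apply: nearW => n; rewrite (le_trans _ (ux n))//.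
by apply: ereal_inf_lbound; exists n => /=.
Qed.

Section Dual.
Variable c : R.
Hypothesis dual : forall phi M, measurable_fun setT phi ->
  (forall x, `|phi x| <= M) ->
  (\int[P]_x (phi x)%:E <= c%:E + \int[m]_x (expR (phi x - 1))%:E)%E.

(** Testing with [k] times the indicator of an [m]-null set leaves the right hand
    side bounded while the left hand side grows like [k P(A)]. *)
Lemma dual_dominates : P `<< m.
Proof.
apply/null_content_dominatesP => A mA mA0.
have mP : P A \is a fin_num by exact: fin_num_measure.
have mT : m setT \is a fin_num by exact: fin_num_measure.
suff H k : k%:R * fine (P A) <= c + fine (m setT).
  apply/eqP; rewrite eq_le measure_ge0 andbT -(fineK mP) lee_fin leNgt.
  apply/negP => PA0; have [k _ /(_ k (leqnn k))] :=
    nbhs_infty_ger ((c + fine (m setT) + 1) / fine (P A)).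
  rewrite /= ler_pdivrMr// => /le_trans /(_ (H k)); lra.
have /= := @dual (fun x => k%:R * \1_A x) k%:R.
have -> : (\int[P]_x (k%:R * \1_A x)%:E = (k%:R * fine (P A))%:E)%E.
  under eq_integral do rewrite EFinM.
  rewrite ge0_integralZl//=; last by apply/measurable_EFinP; exact: measurable_indic.
  by rewrite integral_indic// setIT EFinM fineK.
have mk : measurable_fun setT (fun x : T => k%:R * \1_A x : R).
  by apply: measurable_funM => //; exact: measurable_indic.
have bk x : `|k%:R * \1_A x : R| <= k%:R.
  rewrite normrM ger0_norm// indicE; case: (_ \in _); rewrite ?normr1 ?mulr1//.
  by rewrite normr0 mulr0.
move=> /(_ mk bk) /le_trans H.
rewrite -lee_fin; apply: H; rewrite EFinD leeD2l//.
apply: (@le_trans _ _ (\int[m]_x ((cst 1%:E x) + (expR k%:R)%:E * (\1_A x)%:E))%E).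
  apply: ge0_le_integral => //.
  - by apply/measurable_EFinP; exact: measurable_expRB1.
  - apply: emeasurable_funD => //; apply: measurable_funeM.
    by apply/measurable_EFinP; exact: measurable_indic.
  - move=> x _ /=; rewrite -EFinM -EFinD lee_fin indicE.
    case: (_ \in _); rewrite ?mulr1 ?mulr0.
      by apply: (@le_trans _ _ (expR k%:R)); rewrite ?ler_expR ?lerBlDr ?lerDl ?lerDr.
    by rewrite addr0 sub0r -[leRHS]expR0 ler_expR lerN10.
rewrite ge0_integralD//=; last first.
  apply: measurable_funeM.
  by apply/measurable_EFinP; exact: measurable_indic.
rewrite ge0_integralZl//=; last first.
  by apply/measurable_EFinP; exact: measurable_indic.
by rewrite integral_indic// setIT mA0 mule0 adde0 integral_cst// mul1e fineK.
Qed.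

(** The optimal test function is [1 + ln rho].  Its truncations are bounded, and
    Fatou's lemma recovers [rho ln rho]. *)
Lemma Ent_le_dual : (Ent m P <= c%:E)%E.
Proof.
have Pm := dual_dominates; have [rho rhoD ->] := EntE Pm.
have [mrho rho0 _] := rhoD.
have mT : m setT \is a fin_num by exact: fin_num_measure.
(* The duality bracket at [1 + ln (truncate k rho)] is the integral of [g k]. *)
pose g k x := (1 + ln (truncate k (rho x))) * rho x - truncate k (rho x).
have mln k : measurable_fun setT (fun x => 1 + ln (truncate k (rho x))).
  apply: measurable_funD => //; apply: measurableT_comp; first exact: measurable_ln.
  exact: measurable_truncate.
have lnk k x : `|1 + ln (truncate k (rho x))| <= 1 + ln k.+1%:R.
  by rewrite (le_trans (ler_normD _ _))// normr1 lerD2l ln_truncate_le.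
have mg k : measurable_fun setT (g k).
  apply: measurable_funB; first exact: measurable_funM.
  exact: measurable_truncate.
have itr k : m.-integrable setT (fun x => (truncate k (rho x))%:E).
  apply: (@bounded_integrable _ _ _ _ _ k.+1%:R); first exact: measurable_truncate.
  by move=> x; rewrite ger0_norm ?truncate_le// ltW// truncate_gt0.
have iphi k := integrable_density rhoD (mln k) (lnk k).
have ig k : m.-integrable setT (fun x => (g k x)%:E).
  by under [X in _.-integrable _ X]eq_fun do rewrite EFinB; exact: integrableB.
have gc k : (\int[m]_x (g k x)%:E <= c%:E)%E.
  under eq_integral do rewrite EFinB.
  rewrite integralB//= leeBlDr ?integrable_fin_num//.
  rewrite -(integral_density Pm rhoD (mln k) (lnk k)).
  rewrite (le_trans (dual (mln k) (lnk k)))// leeD2l// le_eqVlt.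
  apply/orP; left; apply/eqP; apply: eq_integral => x _.
  by rewrite addrC addKr lnK// posrE truncate_gt0.
have i2 : m.-integrable setT (fun x : T => 2%:E : \bar R).
  exact: finite_measure_integrable_cst.
have mh := measurable_mul_ln mrho.
have hl x : - 2 <= rho x * ln (rho x).
  by have := mul_ln_ge (rho0 x); have := rho0 x; lra.
have fat : (\int[m]_x (rho x * ln (rho x) + 2)%:E <= c%:E + 2%:E * m setT)%E.
  have -> : (\int[m]_x (rho x * ln (rho x) + 2)%:E =
      \int[m]_x limn_einf (fun k => (g k x + 2)%:E))%E.
    apply: eq_integral => x _; apply/esym.
    apply: (cvg_limn_einf_sup _).1; apply: cvg_EFin; first exact: nearW.
    by apply: cvgD; [exact: cvg_truncate|exact: cvg_cst].
  apply: le_trans (fatou _ _ _ _) _ => //.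
  - by move=> k; apply/measurable_EFinP; exact: measurable_funD.
  - by move=> k x _; rewrite lee_fin -lerBlDr sub0r truncate_lbound.
  apply: limn_einf_le => k; under eq_integral do rewrite EFinD.
  by rewrite integralD//= leeD// integral_cst.
have hi2 : m.-integrable setT (EFin \o (fun x => rho x * ln (rho x) + 2)).
  apply: (@integrable_of_lbound _ _ 0); first exact: measurable_funD.
    by move=> x; have := hl x; lra.
  by rewrite (le_lt_trans fat)// -(fineK mT) -EFinM -EFinD ltry.
have hi : m.-integrable setT (fun x => (rho x * ln (rho x))%:E).
  rewrite (_ : (fun x => _) =
    ((EFin \o (fun x => rho x * ln (rho x) + 2)%R) \- (fun=> 2%:E))%E).
    exact: integrableB.
  by apply/funext => x /=; rewrite -EFinB addrK.
move: fat; under eq_integral do rewrite EFinD.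
rewrite integralD//= integral_cst//= leeD2rE//.
by rewrite -(fineK mT) -EFinM.
Qed.
End Dual.

End FiniteMeasure.
End Entropy.

(** * Lower semicontinuity of the entropy *)

Section EntropyLsc.
Context {R : realType} {X : pmetricType R}.
Variables (m : {finite_measure set (borel X) -> \bar R})
  (mu_ : nat -> {finite_measure set (borel X) -> \bar R})
  (mu : {finite_measure set (borel X) -> \bar R}).
Variables (c_ : nat -> R) (c : R).

(** For a bounded Lipschitz test function the dual inequality passes to the weak
    limit; density in L1 of the sum of [m] and [mu] extends it to all bounded
    measurable test functions, and duality turns it back into a bound on the
    entropy. *)
Lemma Ent_lsc :
  (forall f : X -> R, bounded_lipschitz f ->
    (\int[mu_ n]_x (f x)%:E)%E @[n --> \oo] --> (\int[mu]_x (f x)%:E)%E) ->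
  (forall n, (Ent m (mu_ n) <= (c_ n)%:E)%E) ->
  c_ n @[n --> \oo] --> c ->
  (Ent m mu <= c%:E)%E.
Proof.
move=> wcvg Entc cc.
have lipc (f : borel X -> R) : bounded_lipschitz (f : X -> R) ->
    (\int[mu]_x (f x)%:E <= c%:E + \int[m]_x (expR (f x - 1))%:E)%E.
  move=> fL; have [C [fC _]] := fL.
  have mf := bounded_lipschitz_measurable fL.
  have ie := integrable_expRB1 m mf fC.
  have iefin := integrable_fin_num measurableT ie.
  set I := (\int[m]_x _)%E in iefin *; rewrite -(fineK iefin) -EFinD.
  have fcvg := wcvg f fL.
  have Icvg : (c_ n + fine I)%:E @[n --> \oo] --> (c + fine I)%:E.
    by apply: cvg_EFin; [exact: nearW|apply: cvgD => //; exact: cvg_cst].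
  rewrite -(cvg_lim _ fcvg)// -(cvg_lim _ Icvg)//; apply: lee_lim.
  - exact: cvgP fcvg.
  - exact: cvgP Icvg.
  - apply: nearW => n; rewrite EFinD fineK//.
    have Efin : (Ent m (mu_ n) < +oo)%E by rewrite (le_lt_trans (Entc n))// ltry.
    apply: le_trans (integral_le_Ent Efin mf fC) _.
    by rewrite leeD2r.
apply: Ent_le_dual => phi M mphi phiM.
apply/lee_addgt0Pr => e e0.
(* [expR M] is the cost of comparing the exponentials, [1] that of comparing the
   integrals against [mu]. *)
pose C := expR M + 1; have C0 : 0 < C by rewrite ltr_wpDl// expR_ge0.
pose nm : {measure set (borel X) -> \bar R} := measure_add m mu.
have nm_fin : fin_num_fun nm.
  by move=> A mA; rewrite [nm A]measure_addE fin_numD !fin_num_measure.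
pose nu : {finite_measure set (borel X) -> \bar R} :=
  HB.pack (Measure.sort nm) (Measure_isFinite.Build _ _ _ nm nm_fin).
have [psi [psiL psiM psi_phi]] := @bounded_lipschitz_dense _ _ nu phi M mphi phiM
  (e / C) (divr_gt0 e0 C0).
have mpsi := bounded_lipschitz_measurable psiL.
have mabs := measurable_abs_sub mphi mpsi.
have [mL muL] : (L1dist m phi psi <= (e / C)%:E)%E /\ (L1dist mu phi psi <= (e / C)%:E)%E.
  have H : (L1dist m phi psi + L1dist mu phi psi <= (e / C)%:E)%E.
    by rewrite /L1dist -ge0_integral_measure_add.
  by split; rewrite (le_trans _ H)// ?leeDl ?leeDr//; apply: integral_ge0.
have iphi := bounded_integrable mu mphi phiM.
have ipsi := bounded_integrable mu mpsi psiM.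
have absM x : `| `|phi x - psi x| | <= M + M.
  by rewrite normr_id (le_trans (ler_normB _ _))// lerD.
have mabsR : measurable_fun setT (fun x => `|phi x - psi x|) by exact/measurable_EFinP.
have iabs_mu := bounded_integrable mu mabsR absM.
have iabs_m := bounded_integrable m mabsR absM.
have iephi := integrable_expRB1 m mphi phiM.
have iepsi := integrable_expRB1 m mpsi psiM.
apply: (@le_trans _ _ (\int[mu]_x (psi x)%:E + L1dist mu phi psi)%E).
  rewrite -integralD//; apply: le_integral => //; first exact: integrableD.
  move=> x _; rewrite -EFinD lee_fin -lerBlDl.
  exact: ler_norm.
have exp_close : (\int[m]_x (expR (psi x - 1))%:E <=
    \int[m]_x (expR (phi x - 1))%:E + (expR M)%:E * L1dist m phi psi)%E.
  rewrite -integralZl// -integralD//; last exact: integrableZl.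
  apply: le_integral => //.
    by apply: integrableD => //; exact: integrableZl.
  move=> x _; rewrite -EFinM -EFinD lee_fin.
  have -> : expR (phi x - 1) = expR (psi x - 1) * expR (phi x - psi x).
    by rewrite -expRD; congr expR; ring.
  have h1 : expR (psi x - 1) * (1 + (phi x - psi x)) <=
      expR (psi x - 1) * expR (phi x - psi x).
    by rewrite ler_wpM2l ?expR_ge0 ?expR_ge1Dx.
  have h2 : expR (psi x - 1) * (psi x - phi x) <= expR M * `|phi x - psi x|.
    rewrite (@le_trans _ _ (expR (psi x - 1) * `|phi x - psi x|))//.
      by rewrite ler_wpM2l ?expR_ge0// distrC ler_norm.
    rewrite ler_wpM2r// ler_expR.
    by have := le_trans (ler_norm _) (psiM x); lra.
  lra.
apply: (@le_trans _ _ (c%:E + (\int[m]_x (expR (phi x - 1))%:E +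
    (expR M)%:E * (e / C)%:E) + (e / C)%:E)%E).
  apply: leeD => //; apply: le_trans (lipc psi psiL) _.
  rewrite leeD2l// (le_trans exp_close)// leeD2l//.
  by rewrite lee_wpmul2l// lee_fin expR_ge0.
move: (\int[m]_x (expR (phi x - 1))%:E)%E => I.
rewrite -EFinM -!addeA -EFinD leeD2l// leeD2l// lee_fin.
by rewrite le_eqVlt; apply/orP; left; apply/eqP; rewrite /C; field; rewrite gt_eqF.
Qed.
End EntropyLsc.

(** * Images and reweightings of probabilities *)

Section Measures.
Context {R : realType}.

Definition law d1 d2 (T1 : measurableType d1) (T2 : measurableType d2)
    (P : probability T1 R) (f : T1 -> T2) (mf : measurable_fun setT f) :
    probability T2 R :=
  distribution P (HB.pack_for {mfun T1 >-> T2} f (isMeasurableFun.Build _ _ _ _ f mf)).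

Lemma lawE d1 d2 (T1 : measurableType d1) (T2 : measurableType d2)
    (P : probability T1 R) (f : T1 -> T2) (mf : measurable_fun setT f) :
  law P mf = pushforward P f :> (set T2 -> \bar R).
Proof. by []. Qed.

Lemma integral_law d1 d2 (T1 : measurableType d1) (T2 : measurableType d2)
    (P : probability T1 R) (f : T1 -> T2) (mf : measurable_fun setT f)
    (phi : T2 -> R) (M : R) : measurable_fun setT phi -> (forall x, `|phi x| <= M) ->
  (\int[law P mf]_x (phi x)%:E = \int[P]_x (phi (f x))%:E)%E.
Proof.
move=> mphi phiM; rewrite lawE integral_pushforward//; first exact/measurable_EFinP.
apply: (@bounded_integrable _ _ _ _ (phi \o f) M).
  exact: (measurableT_comp mphi mf).
by move=> x; exact: phiM.
Qed.

(** A normalized density turns the set function [weighted] into a genuine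
    probability, to which the hypotheses on measures can be applied. *)
Lemma weighted_probability d (T : measurableType d) (Q : probability T R)
    (F : T -> R) : measurable_fun setT F -> (forall x, 0 <= F x) ->
  (\int[Q]_x (F x)%:E = 1)%E ->
  exists P : probability T R, P = weighted setT F Q :> (set T -> \bar R).
Proof.
move=> mF F0 F1; pose W := weighted setT F Q.
have mEF : measurable_fun setT (EFin \o F) by exact/measurable_EFinP.
have W0 : W set0 = 0%E by rewrite /W /weighted set0I integral_set0.
have Wge A : (0 <= W A)%E by apply: integral_ge0 => x _; rewrite lee_fin.
have Wadd : semi_sigma_additive W.
  rewrite (_ : W = fun A => (\int[Q]_(x in A) (F x)%:E)%E).
    exact: semi_sigma_additive_nng_induced.
  by apply/funext => A; rewrite /W /weighted setIT.
pose Wm : {measure set T -> \bar R} :=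
  HB.pack_for {measure set T -> \bar R} W (isMeasure.Build _ _ _ W W0 Wge Wadd).
have W1 : Wm setT = 1%E by rewrite /= /W /weighted setIT.
by exists (HB.pack_for (probability T R) (Measure.sort Wm)
  (Measure_isProbability.Build _ _ _ Wm W1)).
Qed.

End Measures.

(** * Continuity and measurability on the space of curves *)

Section Curves.
Context {R : realType} {X : pmetricType R}.
Implicit Type d : X -> X -> R.

Lemma mdist_is_distance : is_distance (mdist : X -> X -> R).
Proof.
split; [move=> x y; split=> [/mdist_positivity//|->]|exact: metric_sym
  |exact: (fun x y z => metric_triangle x y z)].
exact: mdistxx.
Qed.

Lemma mdist_induces_topology : induces_topology (mdist : X -> X -> R).
Proof.
move=> x A; split=> [/metricType_numDomainType.nbhs_mdistP[e /= e0 eA]|[e e0 eA]].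
  by exists e.
by apply/metricType_numDomainType.nbhs_mdistP; exists e.
Qed.

Lemma distance_ge0 d x y : is_distance d -> 0 <= d x y.
Proof.
move=> [d0 dC dD]; have := dD x y x; rewrite (d0 x x).2// (dC y x); lra.
Qed.

(** Stated for any distance inducing the topology, since it serves both the
    reference distance and its approximations. *)
Lemma distance_continuous d : is_distance d -> induces_topology d ->
  continuous (fun z : X * X => d z.1 z.2).
Proof.
move=> [d0 dC dD] dtop [x y]; apply/cvgrPdist_lt => e e0.
have e2 : 0 < e / 2 by rewrite divr_gt0.
exists ([set u | d x u < e / 2], [set v | d y v < e / 2]).
  by split; apply/dtop; exists (e / 2).
move=> [u v] /= [xu yv].
have := dD x u y; have := dD u v y; have := dD u x v; have := dD x y v.
rewrite (dC u x) (dC v y) ltr_norml; lra.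
Qed.

(** Uniform convergence implies pointwise convergence. *)
Lemma ev_continuous (t : I01 R) :
  continuous (ev t : curve_uniform X -> X).
Proof.
move=> g; rewrite /continuous_at.
have idc : continuous (id : curve_uniform X -> {uniform (I01 R) -> X}).
  exact: initial_continuous.
have ptws : {ptws, (id : curve_uniform X -> (I01 R -> X)) h @[h --> g] --> (g : I01 R -> X)}.
  apply: pointwise_uniform_cvg; last exact: idc.
  exact: (@fmap_filter _ _ _ _ (nbhs_filter (g : curve_uniform X))).
exact: (cvg_comp _ _ ptws (@proj_continuous (I01 R) (fun=> X) t _)).
Qed.

Lemma measurable_ev (t : I01 R) : measurable_fun setT (ev t : curve X -> borel X).
Proof. exact: (continuous_borel_measurable (@ev_continuous t)). Qed.

Lemma ev2_continuous (s t : I01 R) :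
  continuous ((fun g => (ev s g, ev t g)) : curve_uniform X -> X * X).
Proof.
move=> g; exact: (@cvg_pair _ _ _ (nbhs (g : curve_uniform X)) (nbhs (ev s g : X))
  (nbhs (ev t g : X)) _ _ _ (ev s) (ev t) (@ev_continuous s g) (@ev_continuous t g)).
Qed.

Lemma closed_Geo d : is_distance d -> induces_topology d ->
  closed (Geo d : set (curve_uniform X)).
Proof.
move=> dd dtop; have dc := distance_continuous dd dtop.
have dst (s t : I01 R) : continuous ((fun g => d (ev s g) (ev t g)) : curve_uniform X -> R).
  move=> g; apply: (@continuous_comp _ _ _ (fun g => (ev s g, ev t g)) (fun z : X * X => d z.1 z.2)).
    exact: ev2_continuous.
  exact: dc.
have -> : Geo d = \bigcap_(s in setT) \bigcap_(t in setT)
    ((fun g => d (ev s g) (ev t g) - `|rv t - rv s| * d (ev I0 g) (ev I1 g)) @^-1` [set x | x = 0]).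
  apply/seteqP; split=> [g gG s _ t _ /=|g gG s t]; first by rewrite gG subrr.
  by have /= := gG s I t I => /subr0_eq.
apply: closed_bigI => s _; apply: closed_bigI => t _.
apply: preimage_closed; last exact: closed_eq.
move=> g _; apply: (@cvgB R R^o (curve_uniform X) (nbhs (g : curve_uniform X))).
  exact: (dst s t g).
exact: (@cvgMl_tmp R (curve_uniform X) (nbhs (g : curve_uniform X)) _ _ _ _ (dst I0 I1 g)).
Qed.

Lemma measurable_Geo d : is_distance d -> induces_topology d ->
  measurable (Geo d : set (curve X)).
Proof.
move=> dd dtop; rewrite -[X in measurable X]setCK; apply: measurableC.
by apply: sub_sigma_algebra; exact/closed_openC/closed_Geo.
Qed.

(** The product sigma-algebra need not contain the open sets of the product
    topology.  A measurable map [G] that selects a curve with prescribed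
    endpoints avoids this difficulty: [h] factors through [G] and a continuous
    function of the curve. *)
Lemma continuous_product_measurable (G : borel X * borel X -> curve X)
    (h : X * X -> R) :
  measurable_fun setT G ->
  (forall x y, ev I0 (G (x, y)) = x /\ ev I1 (G (x, y)) = y) ->
  continuous h -> measurable_fun setT (h : borel X * borel X -> R).
Proof.
move=> mG G01 hc.
have -> : h = (fun g : curve X => h (ev I0 g, ev I1 g)) \o G.
  by apply/funext => -[x y] /=; have [-> ->] := G01 x y.
apply: measurableT_comp => //.
apply: (@continuous_borel_measurableR R (curve_uniform X)
  (fun g => h (ev I0 g, ev I1 g))) => g.
apply: (@continuous_comp _ _ _ (fun g : curve_uniform X => (ev I0 g, ev I1 g)) h).
  exact: ev2_continuous.
exact: hc.
Qed.

End Curves.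

(** * Lipschitz consistent geodesic flows *)

Section Flow.
Context {R : realType} {X : pmetricType R}.
Variables (L : R) (G : borel X * borel X -> curve X).
Hypotheses (L0 : 0 < L) (Gflow : consistent_geodesic_flow mdist G)
  (Glip : lipschitz_flow mdist L G).

Lemma le_curve_dist (d : X -> X -> R) g1 g2 t :
  ((d (ev t g1) (ev t g2))%:E <= curve_dist d g1 g2)%E.
Proof. by apply: ereal_sup_ubound; exists t. Qed.

Lemma flow_dist_le t x1 y1 x2 y2 :
  mdist (flow_at t G (x1, y1) : X) (flow_at t G (x2, y2)) <=
    L * (mdist (x1 : X) x2 + mdist (y1 : X) y2).
Proof.
have := le_trans (le_curve_dist mdist (G (x1, y1)) (G (x2, y2)) t) (Glip x1 y1 x2 y2).
rewrite lee_fin => /le_trans; apply; rewrite ler_pM2l//.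
have a0 : 0 <= mdist (x1 : X) x2 by exact: mdist_ge0.
have b0 : 0 <= mdist (y1 : X) y2 by exact: mdist_ge0.
rewrite -[leRHS]ger0_norm ?addr_ge0// -sqrtr_sqr ler_sqrt ?sqr_ge0//.
by rewrite sqrrD lerD2r lerDl mulrn_wge0// mulr_ge0.
Qed.

Lemma flow_at_continuous t : continuous (flow_at t G : X * X -> X).
Proof.
move=> -[x y]; apply/cvg_ballP => e e0.
have e2 : 0 < e / L / 2 by rewrite !divr_gt0.
exists (ball (x : X) (e / L / 2), ball (y : X) (e / L / 2)) => /=.
  by split; exact: nbhsx_ballx.
move=> [u v]; rewrite !ballEmdist/= => -[xu yv].
rewrite (le_lt_trans (flow_dist_le _ _ _ _ _))// -ltr_pdivlMl// mulrC.
by rewrite [ltRHS]splitr ltrD.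
Qed.

Lemma measurable_flow_at t : measurable_fun setT (flow_at t G).
Proof.
case: Gflow => mG _ _.
exact: (measurableT_comp (measurable_ev t) mG).
Qed.

Lemma flow_ends x y : ev I0 (G (x, y)) = x /\ ev I1 (G (x, y)) = y.
Proof. by case: Gflow => _ /(_ x y)[]. Qed.

Lemma flow_curve_dist s t z : mdist (flow_at s G z : X) (flow_at t G z) =
  `|rv t - rv s| * mdist (z.1 : X) z.2.
Proof.
case: z => x y; case: Gflow => _ /(_ x y)[gG g0 g1] _.
by rewrite [LHS]gG g0 g1.
Qed.

(** The closed-interval version of the consistency of the flow.  Moving both times
    inward by [h] changes each side by [O(h)]: the curve [G z] is Lipschitz in
    time, and [G] is Lipschitz in the endpoints. *)
Lemma flow_consistent (s t r : I01 R) z : rv s < rv t ->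
  flow_at r G (flow_at s G z, flow_at t G z) = flow_at (conv01 s t r) G z.
Proof.
move=> st; apply: (@mdist_positivity R X); apply/eqP; rewrite eq_le mdist_ge0 andbT.
apply/ler_addgt0Pl => e e0; rewrite addr0.
case: z => x y; set D := mdist (x : X) y.
have D0 : 0 <= D by exact: mdist_ge0.
have C0 : 0 < (2 * L + 1) * D + 1.
  by rewrite ltr_wpDl// mulr_ge0// addr_ge0// mulr_ge0// ltW.
(* The first bound keeps the inner times ordered in the open interval, the
   second makes the total error at most [e]. *)
pose h := Num.min ((rv t - rv s) / 4) (e / ((2 * L + 1) * D + 1)).
have h0 : 0 < h by rewrite lt_min !divr_gt0// subr_gt0.
have h1 : h <= (rv t - rv s) / 4 by rewrite ge_min lexx.
have h2 : h * ((2 * L + 1) * D + 1) <= e.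
  by rewrite -ler_pdivlMr// ge_min lexx orbT.
have /andP[s0 s1] := rv_itv s; have /andP[t0 t1] := rv_itv t.
have /andP[r0 r1] := rv_itv r.
have a01 : 0 <= rv s + h <= 1 by lra.
have b01 : 0 <= rv t - h <= 1 by lra.
pose a := mkI01 a01; pose b := mkI01 b01.
have ra : rv a = rv s + h by [].
have rb : rv b = rv t - h by [].
have abE : flow_at r G (flow_at a G (x, y), flow_at b G (x, y)) =
    flow_at (conv01 a b r) G (x, y).
  case: Gflow => _ _ /(_ a b x y); rewrite ra rb => H.
  by rewrite /flow_at -H//; lra.
rewrite (le_trans (metric_triangle _
  (flow_at r G (flow_at a G (x, y), flow_at b G (x, y)) : X) _))//.
have H1 := flow_dist_le r (flow_at s G (x, y)) (flow_at t G (x, y))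
  (flow_at a G (x, y)) (flow_at b G (x, y)).
rewrite !flow_curve_dist ra rb /= -/D in H1.
have H2 := flow_curve_dist (conv01 a b r) (conv01 s t r) (x, y).
rewrite -abE /= -/D in H2.
have rcE (u v : I01 R) : rv (conv01 u v r) = (1 - rv r) * rv u + rv r * rv v by [].
rewrite !rcE ra rb in H2.
have n1 : `|rv s + h - rv s| = h by rewrite addrAC subrr add0r gtr0_norm.
have n2 : `|rv t - h - rv t| = h by rewrite addrAC subrr add0r normrN gtr0_norm.
have n3 : `|(1 - rv r) * rv s + rv r * rv t -
    ((1 - rv r) * (rv s + h) + rv r * (rv t - h))| <= h.
  rewrite (_ : _ - _ = (2 * rv r - 1) * h); last by ring.
  rewrite normrM (gtr0_norm h0) ger_pMl// ler_norml; lra.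
rewrite n1 n2 in H1; rewrite H2.
apply: (@le_trans _ _ (L * (h * D + h * D) + h * D)).
  by rewrite lerD// ler_wpM2r.
rewrite (le_trans _ h2)// -subr_ge0.
rewrite (_ : _ - _ = h) ?ltW//; ring.
Qed.

End Flow.

(** * Comparison of transport costs *)

Section Wasserstein.
Context {R : realType}.

Import HBNNSimple.

(** An integral only sees the values of the set function on measurable sets. *)
Lemma eq_integral_same_measure d (T : measurableType d)
    (mu nu : set T -> \bar R) (f : T -> \bar R) : same_measure mu nu ->
  (\int[mu]_x f x = \int[nu]_x f x)%E.
Proof.
move=> mn; rewrite /integral.
have H (h : {nnsfun T >-> R}) : sintegral mu h = sintegral nu h.
  by apply: eq_fsbigr => r _; rewrite mn.
by congr (ereal_sup _ - ereal_sup _)%E; apply/seteqP; split => _ [h ? <-];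
  exists h.
Qed.

Context {X : pmetricType R}.
Implicit Types (d : X -> X -> R) (mu nu : set (borel X) -> \bar R).

(** Measurability for the product sigma-algebra, in which the costs are
    integrated. *)
Definition measurable_sq d : Prop :=
  measurable_fun setT (fun z : borel X * borel X => d z.1 z.2 ^+ 2).

Lemma cost_ge0 d (pi : set (borel X * borel X) -> \bar R) :
  is_probability pi -> (0 <= cost d pi)%E.
Proof.
move=> [P piP]; rewrite /cost (eq_integral_same_measure _ piP).
by apply: integral_ge0 => z _; rewrite lee_fin sqr_ge0.
Qed.

Lemma cost_le d d' (delta : R) (pi : set (borel X * borel X) -> \bar R) :
  is_probability pi -> measurable_sq d -> measurable_sq d' -> 0 <= delta ->
  (forall x y, d' x y ^+ 2 <= d x y ^+ 2 + delta) ->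
  (cost d' pi <= cost d pi + delta%:E)%E.
Proof.
move=> [P piP] md md' delta0 dd'.
rewrite /cost !(eq_integral_same_measure _ piP).
have -> : delta%:E = (\int[P]_z (cst delta%:E z))%E.
  by rewrite integral_cst//= probability_setT mule1.
have mEd : measurable_fun setT (fun z : borel X * borel X => (d z.1 z.2 ^+ 2)%:E).
  exact/measurable_EFinP.
rewrite -ge0_integralD//; last first.
  by move=> z _; rewrite lee_fin sqr_ge0.
apply: ge0_le_integral => //.
- by move=> z _; rewrite lee_fin sqr_ge0.
- exact/measurable_EFinP.
- by apply: emeasurable_funD => //.
- by move=> z _ /=; rewrite -EFinD lee_fin dd'.
Qed.

(** The two infima range over the same couplings, so a uniform comparison of the
    squared distances carries over. *)
Lemma W2sq_le d d' (delta : R) mu nu :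
  measurable_sq d -> measurable_sq d' -> 0 <= delta ->
  (forall x y, d' x y ^+ 2 <= d x y ^+ 2 + delta) ->
  (W2sq d' mu nu <= W2sq d mu nu + delta%:E)%E.
Proof.
move=> md md' delta0 dd'; rewrite -leeBlDr//.
apply: le_ereal_inf_tmp => _ [pi pic <-]; rewrite leeBlDr//.
have [piP _ _] := pic; rewrite (le_trans _ (cost_le piP md md' delta0 dd'))//.
by apply: ereal_inf_lbound; exists pi.
Qed.

Lemma W2sq_fin_num d (B : R) mu nu pi :
  measurable_sq d -> (forall x y, d x y ^+ 2 <= B) -> coupling mu nu pi ->
  W2sq d mu nu \is a fin_num.
Proof.
move=> md dB pic; rewrite ge0_fin_numE; last first.
  by apply: le_ereal_inf_tmp => _ [pi' [piP _ _] <-]; exact: cost_ge0.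
apply: (@le_lt_trans _ _ (cost d pi)); first by apply: ereal_inf_lbound; exists pi.
have [[P piP] _ _] := pic; rewrite /cost (eq_integral_same_measure _ piP).
apply: (@le_lt_trans _ _ (\int[P]_z (cst B%:E z))%E); last first.
  by rewrite integral_cst//= probability_setT mule1 ltry.
apply: ge0_le_integral => //.
- by move=> z _; rewrite lee_fin sqr_ge0.
- exact/measurable_EFinP.
- by move=> z _; rewrite lee_fin.
Qed.

End Wasserstein.

(** * Consequences of compactness *)

Section Compact.
Context {R : realType} {X : pmetricType R}.
Hypothesis cX : compact [set: X].

Lemma compact_mdist_bounded : exists2 B : R, 0 <= B &
  forall x y : X, mdist x y <= B.
Proof.
have cf : {within [set: X], continuous (mdist (point : X) : X -> R^o)}.
  apply: continuous_subspaceT; apply: (@lipschitz_continuous _ _ _ 1) => x y.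
  rewrite mul1r ler_norml lerBlDr [mdist x y]metric_sym.
  have := metric_triangle (point : X) x y; have := metric_triangle (point : X) y x.
  rewrite (metric_sym x y); lra.
have [M [_ /(_ (`|M| + 1))]] := compact_bounded (continuous_compact cf cX).
have MM : M < `|M| + 1 by rewrite (le_lt_trans (ler_norm _))// ltrDl.
move=> /(_ MM) bM; exists ((`|M| + 1) + (`|M| + 1)); first by rewrite !addr_ge0.
have bd (x : X) : mdist point x <= `|M| + 1.
  have := bM (mdist point x); rewrite /= => H.
  by apply: le_trans (ler_norm _) (H _); exists x.
move=> x y; rewrite (le_trans (metric_triangle _ point _))// lerD//.
by rewrite metric_sym.
Qed.

(** A compact space is a ball, and balls have finite measure. *)
Lemma compact_space_fin_num (m : {measure set (borel X) -> \bar R}) :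
  metric_measure_space m -> fin_num_fun m.
Proof.
move=> [_ _ mfin]; have [B B0 bB] := compact_mdist_bounded.
apply: lty_fin_num_fun.
rewrite (_ : setT = ball (point : X) (B + 1)) ?mfin//.
apply/esym/seteqP; split => // x _; rewrite ballEmdist /=.
by rewrite (le_lt_trans (bB _ _))// ltrDl.
Qed.

End Compact.

(** * Stability of the convexity inequality *)

Section Limit.
Context {R : realType} {X : pmetricType R}.
Variables (m : {finite_measure set (borel X) -> \bar R}) (K : R).
Variables (d_ : nat -> X -> X -> R) (eps : nat -> R) (L : R).
Variables (G_ : nat -> borel X * borel X -> curve X)
  (G : borel X * borel X -> curve X).
Hypothesis cX : compact [set: X].
Hypothesis d_dist : forall n, is_distance (d_ n) /\ induces_topology (d_ n).
Hypothesis eps0 : eps n @[n --> \oo] --> (0 : R).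
Hypothesis d_eps : forall n x y, `|d_ n x y - mdist x y| < eps n.
Hypothesis mG_ : forall n, measurable_fun setT (G_ n).
Hypotheses (L0 : 0 < L) (Gflow : consistent_geodesic_flow mdist G)
  (Glip : lipschitz_flow mdist L G).
Hypothesis G_cvg : forall e : R, 0 < e -> \forall n \near \oo,
  forall z, (curve_dist mdist (G_ n z) (G z) < e%:E)%E.

Lemma measurable_sq_distance (d : X -> X -> R) : is_distance d -> induces_topology d ->
  measurable_sq d.
Proof.
move=> dd dtop; have [mG _ _] := Gflow.
apply: (continuous_product_measurable (h := fun z => d z.1 z.2 ^+ 2) mG).
  by move=> x y; exact: flow_ends Gflow x y.
move=> z; apply: (@continuous_comp _ _ _ (fun z : X * X => d z.1 z.2) (fun r : R => r ^+ 2)).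
  exact: distance_continuous.
exact: exprn_continuous.
Qed.

(** With [B] a bound for the distance, the squared distances differ by at most
    [eps n * (2 * B + eps n)]. The coupling [pi] only serves to make the values
    finite. *)
Lemma cvg_W2sq (mu nu : set (borel X) -> \bar R) pi : coupling mu nu pi ->
  [/\ W2sq mdist mu nu \is a fin_num,
      forall n, W2sq (d_ n) mu nu \is a fin_num &
      fine (W2sq (d_ n) mu nu) @[n --> \oo] --> fine (W2sq mdist mu nu)].
Proof.
move=> pic; have [B B0 bB] := compact_mdist_bounded cX.
have eps_ge0 n : 0 <= eps n.
  by apply: ltW; apply: le_lt_trans (d_eps n point point).
have md := measurable_sq_distance mdist_is_distance mdist_induces_topology.
have md_ n : measurable_sq (d_ n) by apply: measurable_sq_distance; case: (d_dist n).
(* From [a ^ 2 - b ^ 2 = (a - b) (a + b)]. *)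
pose delta n := eps n * (2 * B + eps n).
have delta_ge0 n : 0 <= delta n by rewrite mulr_ge0// addr_ge0// mulr_ge0.
have dd n x y : `|d_ n x y ^+ 2 - mdist x y ^+ 2| <= delta n.
  have := ltW (d_eps n x y) => h; have dn0 := distance_ge0 x y (d_dist n).1.
  have m0 := mdist_ge0 x y.
  rewrite subr_sqr normrM ler_pM// ger0_norm ?addr_ge0//.
  by move: h (bB x y); rewrite ler_norml; lra.
have dB n x y : d_ n x y ^+ 2 <= (B + eps n) ^+ 2.
  have dn0 := distance_ge0 x y (d_dist n).1.
  rewrite ler_sqr ?nnegrE ?addr_ge0//.
  by have := ltW (d_eps n x y); have := bB x y; rewrite ler_norml; lra.
have Wfin : W2sq mdist mu nu \is a fin_num.
  apply: (W2sq_fin_num (B := B ^+ 2) md _ pic) => x y.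
  by rewrite ler_sqr ?nnegrE ?mdist_ge0.
have W_fin n : W2sq (d_ n) mu nu \is a fin_num.
  exact: (W2sq_fin_num (md_ n) (dB n) pic).
split => //; apply/cvgrPdist_le => e e0.
have delta0 : delta n @[n --> \oo] --> 0.
  rewrite -[0 in X in _ --> X](mul0r (2 * B + 0)); apply: cvgM => //.
  by apply: cvgD => //; exact: cvg_cst.
near=> n; have den : delta n <= e by near: n; exact: cvgr_le delta0 _ e0.
apply: le_trans den.
have dle x y : mdist x y ^+ 2 <= d_ n x y ^+ 2 + delta n.
  by have := dd n x y; rewrite ler_norml; lra.
have d_le x y : d_ n x y ^+ 2 <= mdist x y ^+ 2 + delta n.
  by have := dd n x y; rewrite ler_norml; lra.
have := W2sq_le mu nu (md_ n) md (delta_ge0 n) dle.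
have := W2sq_le mu nu md (md_ n) (delta_ge0 n) d_le.
rewrite -(fineK Wfin) -(fineK (W_fin n)) -!EFinD !lee_fin/= ler_norml; lra.
Unshelve. all: by end_near. Qed.

(** Replacing [G_ n] by [G] costs at most the Lipschitz constant of [f] times the
    uniform distance of the flows; what remains is weak convergence tested on the
    continuous function [f o G_t]. *)
Lemma flow_weak_cvg (pi_ : nat -> probability (borel X * borel X)%type R)
    (pi : probability (borel X * borel X)%type R) (t : I01 R)
    (mGt_ : forall n, measurable_fun setT (flow_at t (G_ n)))
    (mGt : measurable_fun setT (flow_at t G)) (f : borel X -> R) :
  weak_cvg pi_ pi -> bounded_lipschitz (f : X -> R) ->
  (\int[law (pi_ n) (mGt_ n)]_x (f x)%:E)%E @[n --> \oo] -->
    (\int[law pi mGt]_x (f x)%:E)%E.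
Proof.
move=> wpi fL; have [C [fC fLip]] := fL.
have mf := bounded_lipschitz_measurable fL.
rewrite (integral_law _ _ mf fC).
under eq_fun do rewrite (integral_law _ _ mf fC).
have fGc : continuous ((f \o flow_at t G) : X * X -> R).
  move=> z; apply: (@continuous_comp _ _ _ (flow_at t G : X * X -> X) (f : X -> R)).
    exact: flow_at_continuous L0 Glip _ _.
  exact: bounded_lipschitz_continuous.
have fGb : exists M, forall z : X * X, `|(f \o flow_at t G) z| <= M.
  by exists C => z; exact: fC.
have mfG : measurable_fun setT (f \o flow_at t G) by exact: measurableT_comp mf mGt.
have mfG_ n : measurable_fun setT (f \o flow_at t (G_ n)).
  exact: measurableT_comp mf (mGt_ n).
have int_fG n : (pi_ n).-integrable setT (EFin \o (f \o flow_at t G)).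
  by apply: bounded_integrable mfG _ => z; exact: fC.
have int_fG_ n : (pi_ n).-integrable setT (EFin \o (f \o flow_at t (G_ n))).
  by apply: bounded_integrable (mfG_ n) _ => z; exact: fC.
have int_pi : pi.-integrable setT (EFin \o (f \o flow_at t G)).
  by apply: bounded_integrable mfG _ => z; exact: fC.
have fin0 : (\int[pi]_z (f (flow_at t G z))%:E)%E \is a fin_num.
  exact: (integrable_fin_num measurableT int_pi).
have fin1 n := integrable_fin_num measurableT (int_fG n).
have fin2 n := integrable_fin_num measurableT (int_fG_ n).
have wcvg : (\int[pi_ n]_z (f (flow_at t G z))%:E)%E @[n --> \oo] -->
    (\int[pi]_z (f (flow_at t G z))%:E)%E := wpi _ fGc fGb.
rewrite -(fineK fin0) in wcvg *; move: wcvg => /fine_cvgP[_ wcvg].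
 apply: cvg_EFin; first exact: nearW fin2.
apply/cvgrPdist_le => e e0; have e2 : 0 < e / 2 by rewrite divr_gt0.
have C0 : 0 < C + 1 by rewrite ltr_wpDl//; exact: le_trans (fC point).
have e3 : 0 < e / 2 / (C + 1) by rewrite divr_gt0.
near=> n.
have close : `|fine (\int[pi]_z (f (flow_at t G z))%:E)%E -
    fine (\int[pi_ n]_z (f (flow_at t G z))%:E)| <= e / 2.
  by near: n; exact: cvgr_dist_le wcvg _ e2.
have unif z : `|f (flow_at t G z) - f (flow_at t (G_ n) z)| <= e / 2.
  have cd : (curve_dist mdist (G_ n z) (G z) < (e / 2 / (C + 1))%:E)%E.
    by move: z; near: n; exact: G_cvg.
  have := le_lt_trans (le_curve_dist mdist (G_ n z) (G z) t) cd.
  rewrite lte_fin => dz.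
  rewrite distrC (le_trans (fLip _ _))//.
  rewrite (@le_trans _ _ ((C + 1) * (e / 2 / (C + 1))))//; last first.
    by rewrite mulrC divfK// gt_eqF.
  by rewrite ler_pM ?mdist_ge0 ?(le_trans _ (fC point)) ?lerDl// ltW.
rewrite (splitr e); apply: le_trans (ler_distD _ _ _) (lerD close _).
have fE (A B : \bar R) : A \is a fin_num -> B \is a fin_num ->
    (`|fine A - fine B|%:E = `|A - B|)%E.
  by move=> /fineK <- /fineK <-.
rewrite -lee_fin (fE _ _ (fin1 n) (fin2 n)) -integralB; [|by []|exact: int_fG|exact: int_fG_].
apply: le_trans (le_abse_integral _ _ _) _ => //.
  by apply/measurable_EFinP; exact: measurable_funB.
apply: (@le_trans _ _ (\int[pi_ n]_z (cst (e / 2)%:E z))%E); last first.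
  by rewrite integral_cst//= probability_setT mule1.
apply: ge0_le_integral => //.
- apply: measurableT_comp => //; apply/measurable_EFinP; exact: measurable_funB.
- by move=> z _ /=; rewrite lee_fin; exact: unif.
Unshelve. all: by end_near. Qed.

(** Finiteness of both endpoint entropies makes the right hand sides real numbers
    that converge, so that [Ent_lsc] applies. *)
Lemma Ent_convexity_limit (mu nu : probability (borel X) R)
    (pi_ : nat -> probability (borel X * borel X)%type R)
    (pi : probability (borel X * borel X)%type R) (t : I01 R) :
  weak_cvg pi_ pi -> coupling mu nu pi ->
  (Ent m mu < +oo)%E -> (Ent m nu < +oo)%E ->
  (forall n, (Ent m (pushforward (pi_ n) (flow_at t (G_ n))) <=
     (1 - rv t)%:E * Ent m mu + (rv t)%:E * Ent m nu
     - (K / 2 * rv t * (1 - rv t))%:E * W2sq (d_ n) mu nu)%E) ->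
  (Ent m (pushforward pi (flow_at t G)) <=
     (1 - rv t)%:E * Ent m mu + (rv t)%:E * Ent m nu
     - (K / 2 * rv t * (1 - rv t))%:E * W2sq mdist mu nu)%E.
Proof.
move=> wpi pic mufin nufin Ecvx.
have [Wfin W_fin Wcvg] := cvg_W2sq pic.
have mGt_ n : measurable_fun setT (flow_at t (G_ n)).
  exact: measurableT_comp (measurable_ev t) (mG_ n).
have mGt : measurable_fun setT (flow_at t G) by exact: measurable_flow_at Gflow t.
have mu_fin : Ent m mu \is a fin_num.
  by rewrite fin_numElt mufin (Ent_gtNy m mu).
have nu_fin : Ent m nu \is a fin_num.
  by rewrite fin_numElt nufin (Ent_gtNy m nu).
pose a := (1 - rv t) * fine (Ent m mu) + rv t * fine (Ent m nu).
have RHS_E W : W \is a fin_num ->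
    ((1 - rv t)%:E * Ent m mu + (rv t)%:E * Ent m nu
     - (K / 2 * rv t * (1 - rv t))%:E * W =
    (a - K / 2 * rv t * (1 - rv t) * fine W)%:E)%E.
  by move=> /fineK {1}<-; rewrite -(fineK mu_fin) -(fineK nu_fin).
rewrite RHS_E//.
apply: (@Ent_lsc _ _ m (fun n => law (pi_ n) (mGt_ n)) (law pi mGt)
  (fun n => a - K / 2 * rv t * (1 - rv t) * fine (W2sq (d_ n) mu nu))).
- by move=> f fL; exact: flow_weak_cvg.
- by move=> n; rewrite -RHS_E//; exact: Ecvx.
- by apply: cvgB; [exact: cvg_cst|apply: cvgM => //; exact: cvg_cst].
Qed.

End Limit.

(** * The very strict curvature-dimension condition *)

Lemma homo_lt_cvg_infty (k : nat -> nat) : {homo k : i j / (i < j)%N} ->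
  k n @[n --> \oo] --> \oo.
Proof.
move=> kh; have kn n : (n <= k n)%N.
  by elim: n => // n IH; apply: leq_ltn_trans IH (kh _ _ _).
move=> A [N _ NA]; exists N => // n /= Nn; apply: NA => /=.
exact: leq_trans Nn (kn n).
Qed.

Lemma conv01_I0 {R : realType} (s t : I01 R) : conv01 s t I0 = s.
Proof. by apply: val_inj => /=; rewrite /rv /= subr0 mul1r mul0r addr0. Qed.

Lemma conv01_I1 {R : realType} (s t : I01 R) : conv01 s t I1 = t.
Proof. by apply: val_inj => /=; rewrite /rv /= subrr mul1r mul0r add0r. Qed.

Lemma W2sq_ext {R : realType} {X : pmetricType R} (d : X -> X -> R)
    (mu nu mu' nu' : set (borel X) -> \bar R) :
  same_measure mu mu' -> same_measure nu nu' -> W2sq d mu nu = W2sq d mu' nu'.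
Proof.
move=> mm nn; rewrite /W2sq (_ : coupling mu nu = coupling mu' nu')//.
apply/funext => pi; apply/propext; split=> -[piP p1 p2]; split => // A mA.
- by rewrite p1// mm.
- by rewrite p2// nn.
- by rewrite p1// mm.
- by rewrite p2// nn.
Qed.

(** On a compact space every probability has a finite second moment. *)
Lemma Pac_dominated {R : realType} {X : pmetricType R}
    (m : set (borel X) -> \bar R) (mu : probability (borel X) R) :
  compact [set: X] -> mu `<< m -> Pac (mdist : X -> X -> R) m mu.
Proof.
move=> cX mum; have [B B0 bB] := compact_mdist_bounded cX; split => //; split.
  by exists mu.
exists point; apply: (@le_lt_trans _ _ (\int[mu]_x (cst (B ^+ 2)%:E x))%E); last first.
  by rewrite integral_cst//= probability_setT mule1 ltry.
apply: ge0_le_integral => //.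
- by move=> x _; rewrite lee_fin sqr_ge0.
- apply/measurable_EFinP; apply: measurable_funX.
  apply: continuous_borel_measurableR.
  apply: (@lipschitz_continuous _ _ _ 1) => x y.
  rewrite mul1r ler_norml; have := metric_triangle (x : X) y point.
  have := metric_triangle (y : X) x point; rewrite (metric_sym y x); lra.
- by move=> x _; rewrite lee_fin ler_sqr ?nnegrE ?mdist_ge0.
Qed.

Theorem proposition2p6 (R : realType) (X : pmetricType R)
  (m : {measure set (borel X) -> \bar R}) (K : R)
  (d_ : nat -> X -> X -> R) (eps : nat -> R) (L : R)
  (G_ : nat -> borel X * borel X -> curve X)
  (G : borel X * borel X -> curve X) (k : nat -> nat)
  (Pi : probability (borel X) R -> probability (borel X) R ->
        probability (borel X * borel X)%type R) :
  compact [set: X] ->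
  metric_measure_space m ->
  (forall n, is_distance (d_ n) /\ induces_topology (d_ n)) ->
  eps n @[n --> \oo] --> (0 : R) ->
  (forall n x y, `|d_ n x y - mdist x y| < eps n) ->
  0 < L ->
  (forall n, consistent_geodesic_flow (d_ n) (G_ n) /\
             lipschitz_flow (d_ n) L (G_ n)) ->
  consistent_geodesic_flow mdist G ->
  lipschitz_flow mdist L G ->
  (* the subsequence along which G_n converges uniformly to G *)
  {homo k : i j / (i < j)%N} ->
  (forall e : R, 0 < e -> \forall n \near \oo,
     forall z, (curve_dist mdist (G_ (k n) z) (G z) < e%:E)%E) ->
  consistent_plan_selection mdist m G Pi ->
  (forall mu nu : probability (borel X) R,
     Pac mdist m mu -> Pac mdist m nu ->
     exists pi_ : nat -> probability (borel X * borel X)%type R,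
     [/\ forall n, OptPlans (d_ (k n)) mu nu (pi_ n),
         exists2 j : nat -> nat, {homo j : a b / (a < b)%N} &
           weak_cvg (pi_ \o j) (Pi mu nu) &
         forall n (t : I01 R),
           (Ent m (pushforward (pi_ n) (flow_at t (G_ (k n)))) <=
             (1 - rv t)%:E * Ent m mu + (rv t)%:E * Ent m nu
             - (K / 2 * rv t * (1 - rv t))%:E * W2sq (d_ (k n)) mu nu)%E]) ->
  very_strict_CD mdist m K.
Proof.
move=> cX mX d_dist eps0 d_eps L0 flow_ Gflow Glip kh Gcvg [Pi_opt Pi_cons] Hyp.
move=> mu0 mu1 P0 P1.
have [mG Gends _] := Gflow.
have mfin : fin_num_fun m by exact: (@compact_space_fin_num R X cX m mX).
pose me : {measure set (borel X) -> \bar R} := Measure.Pack (Measure.class m).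
pose m' : {finite_measure set (borel X) -> \bar R} := HB.pack (Measure.sort me)
  (Measure_isFinite.Build _ _ _ me mfin).
have mGeo : measurable (Geo mdist : set (curve X)).
  exact: measurable_Geo mdist_is_distance mdist_induces_topology.
have GG z : Geo mdist (G z) by case: z => x y; case: (Gends x y).
have Gz z : (ev I0 (G z), ev I1 (G z)) = z.
  by case: z => x y; case: (Gends x y) => _ -> ->.
exists (law (Pi mu0 mu1) mG).
  split.
    exists (~` Geo mdist); split => //; first exact: measurableC.
    rewrite /= lawE /pushforward (_ : _ @^-1` _ = set0) ?measure0//.
    by rewrite -subset0 => z /(_ (GG z)).
  rewrite (_ : pushforward _ _ = Pi mu0 mu1 :> (set _ -> \bar R)); first exact: Pi_opt.
  apply/funext => A; rewrite /pushforward/= lawE /pushforward.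
  by congr (Pi mu0 mu1 _); apply/seteqP; split=> z /=; rewrite Gz.
move=> s0 s1 s01 f mf f0 [M fM] f1 sigma t.
set Pi0 := Pi mu0 mu1; pose F := f \o G.
have mF : measurable_fun setT F.
  by apply: (@measurable_comp _ _ _ _ _ _ (Geo mdist)) => // _ [z _ <-].
have F0 z : 0 <= F z by exact: f0.
have mfE : measurable_fun (Geo mdist) (EFin \o f) by exact/measurable_EFinP.
(* Change of variables along [G], which takes all its values in [Geo]. *)
have change D : measurable D -> (\int[law Pi0 mG]_(g in D `&` Geo mdist) (f g)%:E =
    \int[Pi0]_(z in G @^-1` D) (F z)%:E)%E.
  move=> mD; rewrite lawE ge0_integral_pushforward//.
  - congr integral; apply/seteqP; split=> [z []//|z Dz]; split => //; exact: GG.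
  - exact: measurableI.
  - by apply: measurable_funS mfE => //; exact: subIsetr.
  - by move=> g; rewrite inE => -[_ /f0]; rewrite lee_fin.
have F1 : (\int[Pi0]_z (F z)%:E = 1)%E.
  by rewrite -f1 -(setTI (Geo mdist)) change.
have [Q QE] := weighted_probability mF F0 F1.
have mGt r : measurable_fun setT (flow_at r G) by exact: measurable_flow_at Gflow r.
have sigmaE r : same_measure (at_time r sigma) (law Q (mGt (conv01 s0 s1 r))).
  move=> A mA; rewrite lawE QE /pushforward /weighted setIT.
  rewrite /at_time /sigma /restricted_plan /pushforward /weighted.
  rewrite [in LHS]change//.
  by rewrite -[X in measurable X]setTI; exact: measurable_ev.
have sigma0 : same_measure (at_time I0 sigma) (law Q (mGt s0)).
  by move=> A mA; rewrite sigmaE// conv01_I0.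
have sigma1 : same_measure (at_time I1 sigma) (law Q (mGt s1)).
  by move=> A mA; rewrite sigmaE// conv01_I1.
rewrite (Ent_ext m' (sigmaE t)) (Ent_ext m' sigma0) (Ent_ext m' sigma1).
rewrite (W2sq_ext _ sigma0 sigma1).
set mu := law Q (mGt s0); set nu := law Q (mGt s1).
have mGG : measurable_fun setT (fun z => (flow_at s0 G z, flow_at s1 G z)).
  by apply/measurable_fun_pairP; split; exact: mGt.
have Q_coupling : coupling mu nu (law Q mGG) by split => //; exists (law Q mGG).
have Wfin : W2sq mdist mu nu \is a fin_num.
  have [B B0 bB] := compact_mdist_bounded cX.
  apply: (W2sq_fin_num (B := B ^+ 2) _ _ Q_coupling).
    exact: (measurable_sq_distance Gflow mdist_is_distance mdist_induces_topology).
  by move=> x y; rewrite ler_sqr ?nnegrE ?mdist_ge0.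
(* At the endpoints the coefficient of the possibly infinite entropy vanishes, so
   these times are settled separately. *)
have /andP[] := rv_itv t; rewrite le_eqVlt => /predU1P[t0 _|t0].
  have -> : t = I0 by apply: val_inj; rewrite /= -[LHS]t0.
  by rewrite conv01_I0 /rv/= subr0 mulr0 mul0r !mul0e mul1e sube0 adde0.
rewrite le_eqVlt => /predU1P[t1|t1].
  have -> : t = I1 by apply: val_inj; rewrite /= -[RHS]t1.
  by rewrite conv01_I1 /rv/= subrr mulr0 !mul0e mul1e sube0 add0e.
have mu_gtNy := Ent_gtNy m' mu; have nu_gtNy := Ent_gtNy m' nu.
have t1' : 0 < 1 - rv t by rewrite subr_gt0.
have Ent_neqNy a (x : \bar R) : 0 < a -> (-oo < x)%E -> (a%:E * x != -oo)%E.
  by move=> a0; case: x => [r||]//= _; rewrite ?gt0_muley.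
have [mufin|] := ltP (Ent m mu) +oo%E; last first.
  rewrite leye_eq => /eqP ->; rewrite -(fineK Wfin) -EFinM gt0_muley ?lte_fin//.
  by rewrite !addye ?leey// Ent_neqNy.
have [nufin|] := ltP (Ent m nu) +oo%E; last first.
  rewrite leye_eq => /eqP ->; rewrite -(fineK Wfin) -EFinM gt0_muley ?lte_fin//.
  by rewrite addey ?Ent_neqNy// addye ?leey.
have muPac : Pac mdist m mu.
  by apply: Pac_dominated => //; exact: (@Ent_dominates _ _ _ m' mu).
have nuPac : Pac mdist m nu.
  by apply: Pac_dominated => //; exact: (@Ent_dominates _ _ _ m' nu).
(* Consistency of the plan selection, now that both endpoints are in P_ac. *)
have PiQ : same_measure (pushforward Q (fun z => (flow_at s0 G z, flow_at s1 G z)))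
    (Pi mu nu).
  rewrite QE; apply: (Pi_cons mu0 mu1 P0 P1 s0 s1 s01 F mF F0 _ F1) => //.
  - by exists M => z; exact: fM.
  - by move=> A mA; rewrite -QE.
  - by move=> A mA; rewrite -QE.
have [pi_ [pi_opt [j jh wpi] pi_Ent]] := Hyp mu nu muPac nuPac.
have kj := cvg_comp _ _ (homo_lt_cvg_infty jh) (homo_lt_cvg_infty kh).
have mG_ n : measurable_fun setT (G_ (k (j n))) by case: (flow_ (k (j n))) => -[].
have limit := @Ent_convexity_limit R X m' K (fun n => d_ (k (j n)))
  (fun n => eps (k (j n))) L (fun n => G_ (k (j n))) G cX
  (fun n => d_dist (k (j n))) (cvg_comp _ _ kj eps0) (fun n => d_eps (k (j n)))
  mG_ L0 Gflow Glip _ mu nu (pi_ \o j) (Pi mu nu) t wpi _ mufin nufin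
  (fun n => pi_Ent (j n) t).
apply: le_trans (limit _ _).
- rewrite (@Ent_ext _ _ _ m' _ (pushforward (Pi mu nu) (flow_at t G)))// => A mA.
  rewrite lawE /pushforward -PiQ; last first.
    by rewrite -[X in measurable X]setTI; exact: (mGt t).
  rewrite /pushforward; congr (Q _); apply/seteqP; split => z /=;
    by rewrite (flow_consistent L0 Gflow Glip).
- by move=> e e0; exact: (homo_lt_cvg_infty jh (Gcvg e e0)).
- by case: (Pi_opt mu nu muPac nuPac).
Qed.
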